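(* For any $\mu,\nu\in\mathcal{P}(\mathbb{R}^d)$, $$W^2(\mu,\nu)\ \le\ \frac{4\left(C_{\mathrm P}(\mu)+C_{\mathrm P}(\nu)\right)\mathrm{TV}(\mu,\nu)}{1-\mathrm{TV}(\mu,\nu)},$$ where the right-hand side is understood as $+\infty$ when $\mathrm{TV}(\mu,\nu)=1$.
   Context: $\mathcal{P}(\mathbb{R}^d)$ is the set of Borel probability measures on $\mathbb{R}^d$. $W$ is the $2$-Wasserstein distance: $W^2(\mu,\nu)=\inf_{X\sim\mu,\,Y\sim\nu}\mathbb{E}\left[|X-Y|^2\right]\in[0,\infty]$, the infimum being over all couplings $(X,Y)$ of $\mu$ and $\nu$. Total variation: $\mathrm{TV}(\mu,\nu)=\sup_{A\in\mathcal{B}(\mathbb{R}^d)}|\mu(A)-\nu(A)|$. Poincaré constant: for $\mu\in\mathcal{P}(\mathbb{R}^d)$, $C_{\mathrm P}(\mu)\in[0,\infty]$ is the smallest number such that $\mathrm{Var}_\mu(f)\le C_{\mathrm P}(\mu)\int|\nabla f|^2\,\mathrm{d}\mu$ for all smooth $f:\mathbb{R}^d\to\mathbb{R}$ (equal to $+\infty$ if there is no such finite number). The convention $\infty\cdot0=0$ is used. *)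

(* Defs.v *)
From HB Require Import structures.
From mathcomp Require Import all_boot all_order all_algebra.
From mathcomp Require Import all_classical all_reals all_analysis.

Set Implicit Arguments.
Unset Strict Implicit.
Unset Printing Implicit Defensive.

Import Order.TTheory GRing.Theory Num.Theory.
Import numFieldNormedType.Exports.

Local Open Scope classical_set_scope.
Local Open Scope ring_scope.
Local Open Scope ereal_scope.

(* R^d with its Borel sigma-algebra; as a type it unfolds to 'rV[R]_d. *)
Definition borel_rV (R : realType) (d : nat) :
    measurableType (@open 'rV[R]_d).-sigma :=
  g_sigma_algebraType (@open 'rV[R]_d).

(* The library norm `|x| on 'rV[R]_d is the sup norm, so the squared Euclidean
   norm is written out (both norms induce the same topology). *)
Definition sqnorm2 (R : realType) (d : nat) (x : 'rV[R]_d) : R :=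
  (\sum_(i < d) x ord0 i ^+ 2)%R.

Definition partial (R : realType) (d : nat) (i : 'I_d) (f : 'rV[R]_d -> R) :
    'rV[R]_d -> R :=
  fun x => derive f x (delta_mx ord0 i).

Definition gradient (R : realType) (d : nat) (f : 'rV[R]_d -> R)
    (x : 'rV[R]_d) : 'rV[R]_d :=
  \row_(i < d) partial i f x.

(* C^oo: every iterated partial derivative (including f itself, for s = [::])
   is continuous and again has all its partial derivatives everywhere. *)
Definition smooth (R : realType) (d : nat) (f : 'rV[R]_d -> R) : Prop :=
  forall s : seq 'I_d, let g := foldr (@partial R d) f s in
    continuous g /\ forall (i : 'I_d) (x : 'rV[R]_d),
      derivable g x (delta_mx ord0 i).

(* The set of values E|X - Y|^2 over all couplings (X, Y) of mu and nu. The
   laws are compared on measurable sets only, since the values of a measure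
   outside its sigma-algebra are irrelevant. *)
Definition coupling_costs (R : realType) (d : nat)
    (mu nu : probability (borel_rV R d) R) : set (\bar R) :=
  [set e | exists (dO : measure_display) (Omega : measurableType dO)
      (P : probability Omega R) (X Y : {RV P >-> borel_rV R d}),
    [/\ forall A, measurable A -> distribution P X A = mu A,
        forall A, measurable A -> distribution P Y A = nu A &
        e = 'E_P[fun w => sqnorm2 ((X w : 'rV[R]_d) - (Y w : 'rV[R]_d))%R] ]].

(* W^2, the square of the 2-Wasserstein distance. *)
Definition W2sq (R : realType) (d : nat)
    (mu nu : probability (borel_rV R d) R) : \bar R :=
  ereal_inf (coupling_costs mu nu).

Definition TV (R : realType) (d : nat)
    (mu nu : probability (borel_rV R d) R) : \bar R :=
  ereal_sup [set `|mu A - nu A| | A in measurable].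

(* A smooth f that is not square-integrable has 'V_mu[f] = +oo: when 'E_mu[f]
   is infinite or undefined, the library centres f at fine 'E_mu[f] = 0. *)
Definition poincare_bound (R : realType) (d : nat)
    (mu : probability (borel_rV R d) R) (C : R) : Prop :=
  (0 <= C)%R /\ forall f : 'rV[R]_d -> R, smooth f ->
    'V_mu[f] <= C%:E * \int[mu]_x (sqnorm2 (gradient f x))%:E.

(* The infimum over the empty set is +oo. *)
Definition CP (R : realType) (d : nat)
    (mu : probability (borel_rV R d) R) : \bar R :=
  ereal_inf [set C%:E | C in poincare_bound mu].

(* Main.v *)
Require Import Defs.
From HB Require Import structures.
From mathcomp Require Import all_boot all_order all_algebra.
From mathcomp Require Import all_classical all_reals all_analysis.
From mathcomp Require Import measurable_realfun ring lra.

(* A Hamilton-Jacobi argument on a path through the common part of mu and nu,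
   discretised in space (finite transport problem) and in time (Jensen), so that
   no PDE and no compactness is needed.

   Let sg be the common part of mu and nu (Hahn decomposition of mu - nu) and m its
   normalisation; its mass is at least 1 - TV.  A function G of mean A under mu and
   mean c under m satisfies (A - c)^2 <= (TV / (1 - TV)) * Var_mu(G), so the Poincare
   inequality bounds (A - c)^2 by the energy of G under mu; likewise for nu.

   Kantorovich duality is used only for finite problems, where it follows from
   Farkas' lemma.  A dual potential on finitely many points y_j evolves by the
   soft-min
     G_s(x) = - eps * ln (1/n * sum_j exp (- (f_j + |x - y_j|^2 / (2 s)) / eps)),
   an explicit smooth function.  By Jensen, for s < s',
     G_s' <= G_s - (s' - s) (s / s') / 2 * |grad G_s|^2,
   a discrete Hamilton-Jacobi inequality without error term.  Integrating G_s
   along the path (1 - s)^2 mu + s^2 nu + 2 s (1 - s) m and absorbing the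
   variation of the weights into the energy costs 2 (C1 + C2) TV / (1 - TV). *)

Set Implicit Arguments.
Unset Strict Implicit.
Unset Printing Implicit Defensive.
Import Order.TTheory GRing.Theory Num.Theory.
Import numFieldNormedType.Exports.
Local Open Scope classical_set_scope.
Local Open Scope ring_scope.

(** * Finite transport duality *)

(** Induction on the number of generators. If the functional [y] that separates [b] from the other
    generators is negative on the last one, everything is projected along that generator onto the
    kernel of [y] and the induction hypothesis is applied again. *)
Lemma farkas (R : realFieldType) (m n : nat) (a : 'I_n -> 'cV[R]_m) (b : 'cV[R]_m) :
  (exists2 l : 'I_n -> R, (forall i, 0 <= l i) & b = \sum_i l i *: a i) \/
  (exists2 y : 'rV[R]_m, (forall i, 0 <= (y *m a i) 0 0) & (y *m b) 0 0 < 0).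
Proof.
elim: n a b => [|n IHn] a b.
  have [->|b0] := eqVneq b 0.
    by left; exists (fun=> 0) => //; rewrite big_ord0.
  right; exists (- b^T); first by case.
  rewrite mulNmx mxE oppr_lt0 mxE lt_def sumr_ge0 ?andbT; last first.
    by move=> i _; rewrite !mxE -expr2 sqr_ge0.
  apply: contra b0; rewrite psumr_eq0; last first.
    by move=> i _; rewrite !mxE -expr2 sqr_ge0.
  move=> /allP b0; apply/eqP/matrixP => i j; rewrite ord1 mxE.
  have := b0 i (mem_index_enum i); rewrite !mxE -expr2 sqrf_eq0.
  by move=> /eqP.
have [[l l0 bE]|[y ya yb]] := IHn (fun i => a (lift ord_max i)) b.
  left; exists (fun i => if unlift ord_max i is Some j then l j else 0).
    by move=> i; case: unliftP => [j _|//].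
  rewrite (bigD1_ord ord_max)//= unlift_none scale0r add0r bE.
  by apply: eq_bigr => j _; rewrite liftK.
have [yn0|yn0] := leP 0 ((y *m a ord_max) 0 0).
  right; exists y => // i; case: (unliftP ord_max i) => [j ->|->//].
  exact: ya.
set yn := (y *m a ord_max) 0 0 in yn0.
have ynN0 : yn != 0 by rewrite lt_eqF.
pose pr (v : 'cV[R]_m) := v - ((y *m v) 0 0 / yn) *: a ord_max.
have [[l l0 bE]|[z za zb]] := IHn (fun i => pr (a (lift ord_max i))) (pr b).
  left.
  (* The coefficient forced by undoing the projection. It is nonnegative because [y] is negative on
     [b] and on the last generator, and nonnegative on the others. *)
  pose ln := (y *m b) 0 0 / yn
     - \sum_i l i * ((y *m a (lift ord_max i)) 0 0 / yn).
  exists (fun i => if unlift ord_max i is Some j then l j else ln).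
    move=> i; case: unliftP => [j _|_] /=; first exact: l0.
    rewrite /ln subr_ge0.
    apply: (@le_trans _ _ 0).
      apply: sumr_le0 => k _; rewrite mulr_ge0_le0//.
      by rewrite mulr_ge0_le0// invr_le0 ltW.
    by rewrite mulr_le0// ?invr_le0 ltW.
  rewrite (bigD1_ord ord_max)//= unlift_none.
  under eq_bigr do rewrite liftK.
  have prE : \sum_i l i *: pr (a (lift ord_max i)) =
      \sum_i l i *: a (lift ord_max i) -
      (\sum_i l i * ((y *m a (lift ord_max i)) 0 0 / yn)) *: a ord_max.
    by rewrite scaler_suml -sumrB; apply: eq_bigr => i _; rewrite scalerBr scalerA.
  have -> : b = pr b + ((y *m b) 0 0 / yn) *: a ord_max by rewrite subrK.
  rewrite {1}bE prE /ln scalerBl.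
  by rewrite addrAC [RHS]addrAC (addrC (_ *: _) (\sum_i _)).
(* [y'] is [z] composed with the projection, so it vanishes on the last generator. *)
right; pose y' := z - ((z *m a ord_max) 0 0 / yn) *: y.
have y'E v : (y' *m v) 0 0 = (z *m pr v) 0 0.
  rewrite /y' /pr mulmxBl mulmxBr -scalemxAl -scalemxAr.
  have BE (A B : 'M[R]_1) : (A - B) 0 0 = A 0 0 - B 0 0 by rewrite !mxE.
  have ZE k (A : 'M[R]_1) : (k *: A) 0 0 = k * A 0 0 by rewrite mxE.
  by rewrite BE [RHS]BE !ZE; congr (_ - _); ring.
exists y'; last by rewrite y'E.
move=> i; rewrite y'E; case: (unliftP ord_max i) => [j ->|->]; first exact: za.
by rewrite /pr divff// scale1r subrr mulmx0 mxE.
Qed.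

(** Farkas' lemma for the vectors [(e_i, e_j, c i j)], the slack vector [(0, 0, 1)] and the target
    [(al, be, K)]: lying in the cone means having a plan of cost at most [K], and a separating
    functional [(f, g, k)] would violate the dual bound. *)
Lemma transport_duality (R : realFieldType) (n : nat) (al be : 'I_n -> R)
    (c : 'I_n -> 'I_n -> R) (K : R) :
  (forall i, 0 <= al i) -> (forall i, 0 <= be i) ->
  \sum_i al i = 1 -> \sum_i be i = 1 ->
  (forall f g : 'I_n -> R, (forall i j, f i + g j <= c i j) ->
    \sum_i f i * al i + \sum_j g j * be j <= K) ->
  exists p : 'I_n -> 'I_n -> R, [/\ forall i j, 0 <= p i j,
    forall i, \sum_j p i j = al i, forall j, \sum_i p i j = be j &
    \sum_i \sum_j p i j * c i j <= K].
Proof.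
move=> al0 be0 al1 be1 dual.
pose v (f g : 'I_n -> R) (k : R) : 'cV[R]_(n + (n + 1)) :=
  col_mx (\col_i f i) (col_mx (\col_i g i) k%:M).
have vE y f g k : ((y : 'rV_(n + (n + 1))) *m v f g k) 0 0 =
    \sum_i lsubmx y 0 i * f i + (\sum_i lsubmx (rsubmx y) 0 i * g i +
    rsubmx (rsubmx y) 0 0 * k).
  rewrite -{1}(hsubmxK y) -{1}(hsubmxK (rsubmx y)) /v mul_row_col [LHS]mxE [X in X + _]mxE.
  congr (_ + _); first by apply: eq_bigr => i _; rewrite [X in _ * X]mxE.
  rewrite mul_row_col mxE; congr (_ + _).
    by rewrite mxE; apply: eq_bigr => i _; rewrite [X in _ * X]mxE.
  by rewrite [LHS]mxE big_ord1 [X in _ * X]mxE eqxx mulr1n.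
pose T : finType := ('I_n * 'I_n + unit)%type.
pose gen (t : T) := match t with
  | inl (i, j) => v (fun k => (k == i)%:R) (fun k => (k == j)%:R) (c i j)
  | inr _ => v (fun=> 0) (fun=> 0) 1 end.
have [[l l0 bE]|[y ya yb]] :=
    farkas (fun i : 'I_#|T| => gen (enum_val i)) (v al be K).
  have {}bE : v al be K = \sum_t l (enum_rank t) *: gen t.
    rewrite bE [RHS](reindex (@enum_val T T))/=; last exact/onW_bij/enum_val_bij.
    by apply: eq_bigr => i _; rewrite enum_valK.
  pose p i j := l (enum_rank (inl (i, j) : T)).
  have {}bE : v al be K = \sum_i \sum_j p i j *: gen (inl (i, j)) +
      l (enum_rank (inr tt : T)) *: gen (inr tt).
    rewrite bE (@big_sumType _ _ _ _ _ xpredT)/= pair_bigA/=; congr (_ + _).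
      by apply: eq_bigr => -[i j].
    by rewrite (big_pred1 tt)// => -[].
  have vu f g k i : v f g k (lshift _ i) 0 = f i by rewrite col_mxEu mxE.
  have vm f g k i : v f g k (rshift _ (lshift _ i)) 0 = g i.
    by rewrite col_mxEd col_mxEu mxE.
  have vd f g k : v f g k (rshift _ (rshift _ 0)) 0 = k.
    by rewrite !col_mxEd mxE eqxx mulr1n.
  have proj r : v al be K r 0 = \sum_i \sum_j p i j * gen (inl (i, j)) r 0 +
      l (enum_rank (inr tt : T)) * gen (inr tt) r 0.
    rewrite bE mxE summxE; congr (_ + _); last by rewrite mxE.
    apply: eq_bigr => i _; rewrite summxE; apply: eq_bigr => j _.
    by rewrite mxE.
  exists p; split=> [i j|i|j|]; first exact: l0.
  - have := proj (lshift _ i); rewrite !vu mulr0 addr0 => ->.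
    rewrite [RHS](bigD1 i)//= [X in _ + X]big1 ?addr0.
      by apply: eq_bigr => j _; rewrite vu eqxx mulr1.
    by move=> k ki; rewrite big1// => j _; rewrite vu eq_sym (negbTE ki) mulr0.
  - have := proj (rshift _ (lshift _ j)); rewrite !vm mulr0 addr0 => ->.
    apply: eq_bigr => i _; rewrite (bigD1 j)//= vm eqxx mulr1 big1 ?addr0//.
    by move=> k kj; rewrite vm eq_sym (negbTE kj) mulr0.
  - have := proj (rshift _ (rshift _ 0)); rewrite !vd mulr1 => ->.
    rewrite -[leLHS]addr0 lerD//; apply: ler_sum => i _; apply: ler_sum => j _.
    by rewrite vd.
pose f i := lsubmx y 0 i; pose g i := lsubmx (rsubmx y) 0 i.
pose k := rsubmx (rsubmx y) 0 0.
have sum_delta (h : 'I_n -> R) i : \sum_j h j * (j == i)%:R = h i.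
  rewrite (bigD1 i)//= eqxx mulr1 big1 ?addr0// => j /negbTE ->.
  by rewrite mulr0.
have yc i j : 0 <= f i + g j + k * c i j.
  have := ya (enum_rank (inl (i, j) : T)).
  by rewrite enum_rankK vE -/k !sum_delta addrA.
have k0 : 0 <= k.
  have := ya (enum_rank (inr tt : T)); rewrite enum_rankK vE -/k mulr1.
  by rewrite !big1 ?add0r// => i _; rewrite mulr0.
move: yb; rewrite vE -/k => yb.
have prodE (F G : 'I_n -> R) : \sum_i \sum_j (F i + G j) * (al i * be j) =
    \sum_i F i * al i + \sum_j G j * be j.
  transitivity (\sum_i (F i * al i + al i * \sum_j G j * be j)).
    apply: eq_bigr => i _; rewrite mulr_sumr -[F i * al i]mulr1 -be1 mulr_sumr.
    by rewrite -big_split/=; apply: eq_bigr => j _; ring.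
  by rewrite big_split/= -mulr_suml al1 mul1r.
(* If [k = 0], averaging [f i + g j >= 0] against the product plan contradicts [yb]; if [k > 0], the
   pair [- f / k], [- g / k] is dual feasible with value above [K]. *)
exfalso; have [k00|kn0] := eqVneq k 0.
  move: yb; rewrite k00 mul0r addr0 -prodE ltNge => /negP; apply.
  apply: sumr_ge0 => i _; apply: sumr_ge0 => j _.
  by rewrite mulr_ge0 ?mulr_ge0//; have := yc i j; rewrite k00 mul0r addr0.
have {}k0 : 0 < k by rewrite lt_def kn0.
have := dual (fun i => - f i / k) (fun j => - g j / k).
have sumNE (F u : 'I_n -> R) : \sum_i (- F i / k) * u i = - (\sum_i F i * u i) / k.
  by rewrite -sumrN mulr_suml; apply: eq_bigr => i _; ring.
rewrite !sumNE -mulrDl ler_pdivrMr// => dualK.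
suff /dualK : forall i j, - f i / k + - g j / k <= c i j.
  by move: yb; rewrite -/f -/g mulrC; lra.
move=> i j; rewrite -mulrDl ler_pdivrMr//; have := yc i j; lra.
Qed.

(** * The time-discretised interpolation *)

(** Young's inequality: [p ^+ 2 * E] is at least [(p * |x|) ^+ 2 / K], and what remains is a
    square. *)
Lemma interpolation_step (R : realFieldType) (K l p q v x E : R) :
  0 < K -> 0 < l -> 0 <= p -> 0 <= v -> v <= q * p -> x ^+ 2 <= K * E ->
  v * x <= l * (p ^+ 2 * E) + K * q ^+ 2 / (4 * l).
Proof.
move=> K0 l0 p0 v0 vq xE.
have h1 : v * x <= q * (p * `|x|).
  apply: (@le_trans _ _ (v * `|x|)); first by rewrite ler_wpM2l// ler_norm.
  by rewrite mulrA ler_wpM2r.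
have h2 : l / K * (p * `|x|) ^+ 2 <= l * (p ^+ 2 * E).
  rewrite exprMn real_normK ?num_real// -mulrA (ler_wpM2l (ltW l0))//.
  by rewrite mulrCA ler_wpM2l ?sqr_ge0// ler_pdivrMl.
apply: (le_trans h1); apply: le_trans (lerD h2 (lexx _)).
rewrite -subr_ge0.
have -> : l / K * (p * `|x|) ^+ 2 + K * q ^+ 2 / (4 * l) - q * (p * `|x|) =
    l / K * (p * `|x| - K * q / (2 * l)) ^+ 2.
  by field; rewrite !gt_eqF.
by rewrite mulr_ge0 ?sqr_ge0// divr_ge0 ?ltW.
Qed.

Lemma small_multiples_le0 (R : realType) (P W : R) (N0 : nat) :
  (forall N, (N0 <= N)%N -> P <= N.+1%:R^-1 * W) -> P <= 0.
Proof.
move=> h; rewrite leNgt; apply/negP => P0.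
pose N := maxn N0 (Num.bound (`|W| / P)).
have := h N (leq_maxl _ _); rewrite ler_pdivlMl// leNgt => /negP; apply.
rewrite mulrC -ltr_pdivrMl// mulrC.
have WP : `|W| / P < N.+1%:R.
  apply: (lt_le_trans (archi_boundP _)); first by rewrite divr_ge0// ltW.
  by rewrite ler_nat leqW// leq_maxr.
by apply: le_lt_trans WP; rewrite ler_pM2r ?invr_gt0// ler_norm.
Qed.

(** [A], [B], [c] stand for the means of the evolving potential under [mu], [nu] and the normalised
    common part, [E1] and [E2] for its energies. The mean [D] under the mixture is followed while
    time and mixture parameter advance together; the energy lost in each step pays for the change of
    weights. *)
Lemma interpolation_bound (R : realType) (s0 K1 K2 : R) (A B c E1 E2 : R -> R) :
  0 < s0 < 1 -> 0 < K1 -> 0 < K2 ->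
  (forall s s', s0 <= s -> s < s' -> s' <= 1 ->
    A s' <= A s - (s' - s) * (s / s') / 2 * E1 s) ->
  (forall s s', s0 <= s -> s < s' -> s' <= 1 ->
    B s' <= B s - (s' - s) * (s / s') / 2 * E2 s) ->
  (forall s s', s0 <= s -> s < s' -> s' <= 1 -> c s' <= c s) ->
  (forall s, s0 <= s -> s <= 1 -> (A s - c s) ^+ 2 <= K1 * E1 s) ->
  (forall s, s0 <= s -> s <= 1 -> (B s - c s) ^+ 2 <= K2 * E2 s) ->
  (1 - s0) * (B 1 - A s0) <= 2 * (K1 + K2).
Proof.
move=> /andP[s00 s01] K10 K20 hA hB hc hAc hBc.
pose D s th := (1 - th) ^+ 2 * A s + th ^+ 2 * B s + 2 * th * (1 - th) * c s.
(* The weights of [D] sum to 1, so moving [th] by [u] costs [u * (2 * (1 - (th + u)) + u)] times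
   [c - A] plus [u * (2 * th + u)] times [B - c]. The condition on [w] bounds the first factor by a
   multiple of [1 - (th + u)], as [interpolation_step] requires. *)
have step s s' th u w : s0 <= s -> s < s' -> s' <= 1 -> 0 <= th -> 0 <= u ->
    th + u <= 1 -> 0 <= w -> u <= w * (1 - (th + u)) ->
    D s' (th + u) <= D s th +
      (K1 + K2) * (u * (2 + w)) ^+ 2 / (4 * ((s' - s) * (s / s') / 2)).
  move=> s0s ss' s'1 th0 u0 thu1 w0 uw; set l := (s' - s) * (s / s') / 2.
  have sgt0 : 0 < s by apply: lt_le_trans s0s.
  have l0 : 0 < l.
    by rewrite /l divr_gt0// mulr_gt0 ?subr_gt0// divr_gt0//; lra.
  have s1 : s <= 1 by lra.
  have p0 : 0 <= 1 - (th + u) by lra.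
  have tu0 : 0 <= th + u by lra.
  pose q := u * (2 + w).
  have qA : u * (2 * (1 - (th + u)) + u) <= q * (1 - (th + u)).
    by rewrite /q -mulrA ler_wpM2l//; lra.
  have qB : u * (2 * th + u) <= q * (th + u).
    by rewrite /q -mulrA ler_wpM2l//; have := mulr_ge0 w0 tu0; lra.
  have xA : (c s - A s) ^+ 2 <= K1 * E1 s by rewrite -sqrrN opprB hAc.
  have vA0 : 0 <= u * (2 * (1 - (th + u)) + u) by rewrite mulr_ge0//; lra.
  have vB0 : 0 <= u * (2 * th + u) by rewrite mulr_ge0//; lra.
  have := interpolation_step K10 l0 p0 vA0 qA xA.
  have := interpolation_step K20 l0 tu0 vB0 qB (hBc _ s0s s1).
  rewrite /q; set M1 := K1 * _ / (4 * l); set M2 := K2 * _ / (4 * l) => iA iB.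
  have jA : (1 - (th + u)) ^+ 2 * A s' <= (1 - (th + u)) ^+ 2 * (A s - l * E1 s).
    by rewrite ler_wpM2l ?sqr_ge0// hA.
  have jB : (th + u) ^+ 2 * B s' <= (th + u) ^+ 2 * (B s - l * E2 s).
    by rewrite ler_wpM2l ?sqr_ge0// hB.
  have jc : 2 * (th + u) * (1 - (th + u)) * c s' <= 2 * (th + u) * (1 - (th + u)) * c s.
    by rewrite ler_wpM2l ?hc// mulr_ge0// mulr_ge0.
  rewrite mulrDl mulrDl -/M1 -/M2 /D; lra.
have [sN sNs0] : exists N0, forall N, (N0 <= N)%N -> N.+1%:R^-1 < s0.
  exists (Num.bound s0^-1) => N hN; rewrite invf_plt ?posrE//.
  apply: lt_le_trans (archi_boundP _) _; first by rewrite invr_ge0 ltW.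
  by rewrite ler_nat leqW.
pose W0 := `|B 1 - A 1| + 2 * `|B 1 - c 1|.
set L := B 1 - A s0; set K := K1 + K2.
have main N d : (sN <= N)%N -> d = N.+1%:R^-1 ->
    (L - d * W0) * (2 * (1 - s0) * (1 - d / s0)) <= K * (2 + d) ^+ 2.
  (* With [n = (N + 1)^2] steps the path stops at [th = 1 - d], so that the
     weight [(1 - th)^2] of [A] stays large compared to its increments; jumping
     from there to [th = 1] costs at most [d * W0]. *)
  move=> hN dE.
  have d0 : 0 < d by rewrite dE invr_gt0.
  have ds0 : d < s0 by rewrite dE sNs0.
  have d1 : d <= 1 by lra.
  have rho0 : 0 < 1 - d / s0 by rewrite subr_gt0 ltr_pdivrMr// mul1r.
  pose n := (N.+1 ^ 2)%N; pose h := d ^+ 2.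
  have h0 : 0 < h by rewrite exprn_gt0.
  have nh : n%:R * h = 1.
    by rewrite /n /h dE natrX -exprMn divff ?expr1n// pnatr_eq0.
  pose s_ k := s0 + (1 - s0) * (k%:R * h); pose th_ k := (1 - d) * (k%:R * h).
  (* The cost of one step for [w = d], with [u] replaced by its bound [h] and the ratio [s / s'] by
     its lower bound [1 - d / s0]. *)
  pose stp := K * h * (2 + d) ^+ 2 / (2 * (1 - s0) * (1 - d / s0)).
  have ind k : (k <= n)%N -> D (s_ k) (th_ k) <= A s0 + k%:R * stp.
    elim: k => [_|k IH kn]; first by rewrite /D /s_ /th_ !mul0r !mulr0 !addr0; lra.
    have kh1 : k.+1%:R * h <= 1 by rewrite -[leRHS]nh (ler_wpM2r (ltW h0))// ler_nat.
    have kh0 : 0 <= k%:R * h by rewrite mulr_ge0// ltW.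
    have khS : k.+1%:R * h = k%:R * h + h by rewrite -natr1 mulrDl mul1r.
    have s0k : s0 <= s_ k by rewrite /s_ lerDl mulr_ge0//; lra.
    have sS : s_ k.+1 = s_ k + (1 - s0) * h by rewrite /s_ khS; ring.
    have thS : th_ k.+1 = th_ k + (1 - d) * h by rewrite /th_ khS; ring.
    have s'0 : 0 < s_ k.+1.
      by rewrite sS ltr_pwDl// ?mulr_ge0//; lra.
    have hs : 0 < (1 - s0) * h by rewrite mulr_gt0//; lra.
    have th1 : th_ k.+1 <= 1 - d.
      by rewrite /th_ -[leRHS]mulr1 ler_wpM2l//; lra.
    have uh : (1 - d) * h <= h by rewrite -[leRHS]mul1r (ler_wpM2r (ltW h0))//; lra.
    have u0 : 0 <= (1 - d) * h by rewrite mulr_ge0 ?ltW//; lra.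
    have := @step (s_ k) (s_ k.+1) (th_ k) ((1 - d) * h) d s0k _ _ _ u0.
    rewrite -thS => /(_ _ _ _ _ (ltW d0)) H.
    apply: (le_trans (H _ _ _ _ _)).
    - by rewrite sS ltrDl.
    - by rewrite /s_; have := ler_wpM2l (_ : 0 <= 1 - s0) kh1; lra.
    - by rewrite /th_ mulr_ge0//; lra.
    - by lra.
    - apply: (le_trans uh); rewrite /h expr2 (ler_wpM2l (ltW d0))//; lra.
    have -> : k.+1%:R * stp = k%:R * stp + stp by rewrite -natr1 mulrDl mul1r.
    rewrite addrA lerD ?IH ?(ltnW kn)//.
    (* One step increases [s] by at most [h <= d], while [s] stays above [s0]. *)
    have rat : 1 - d / s0 <= s_ k / s_ k.+1.
      rewrite ler_pdivlMr// mulrBl mul1r lerBlDr sS lerD2l -sS.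
      apply: (@le_trans _ _ (d / s0 * s0)).
        rewrite divfK ?gt_eqF//; apply: (@le_trans _ _ h).
          by rewrite -[leRHS]mul1r (ler_wpM2r (ltW h0))//; lra.
        by rewrite /h expr2 -[leRHS]mulr1 (ler_wpM2l (ltW d0)).
      rewrite ler_wpM2l ?divr_ge0 ?ltW//; lra.
    rewrite /stp -/K sS [_ - s_ k]addrAC subrr add0r -sS.
    have -> : 4 * ((1 - s0) * h * (s_ k / s_ k.+1) / 2) =
        2 * (1 - s0) * (s_ k / s_ k.+1) * h by set q := s_ k / s_ k.+1; field.
    have -> : K * h * (2 + d) ^+ 2 / (2 * (1 - s0) * (1 - d / s0)) =
        K * (h * (2 + d)) ^+ 2 / (2 * (1 - s0) * (1 - d / s0) * h).
      by field; rewrite !gt_eqF//; lra.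
    have K0 : 0 <= K by rewrite addr_ge0// ltW.
    have s10 : 0 < 2 * (1 - s0) by lra.
    rewrite ler_pM//.
    - by rewrite mulr_ge0 ?sqr_ge0.
    - by rewrite invr_ge0 ltW// mulr_gt0// mulr_gt0// (lt_le_trans rho0 rat).
    - rewrite ler_wpM2l// lerXn2r ?nnegrE//.
      + by rewrite mulr_ge0//; lra.
      + by rewrite mulr_ge0// ?(ltW h0)//; lra.
      + by rewrite ler_wpM2r//; lra.
    - have q0 := lt_le_trans rho0 rat.
      rewrite lef_pV2 ?posrE; [|by rewrite mulr_gt0// mulr_gt0..].
      by rewrite (ler_wpM2r (ltW h0))// (ler_wpM2l (ltW s10)).
  have := ind n (leqnn _); rewrite /s_ /th_ nh !mulr1 (_ : s0 + (1 - s0) = 1); last by ring.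
  have -> : n%:R * stp = K * (2 + d) ^+ 2 / (2 * (1 - s0) * (1 - d / s0)).
    by rewrite /stp -[RHS]mul1r -[X in _ = X * _]nh !mulrA; congr (_ / _); ring.
  move=> ub; rewrite -ler_pdivlMr; last by rewrite !mulr_gt0//; lra.
  have : B 1 - D 1 (1 - d) <= d * W0.
    have -> : B 1 - D 1 (1 - d) =
        d * (d * (B 1 - A 1) + 2 * ((1 - d) * (B 1 - c 1))).
      by rewrite /D; ring.
    have x1 : d * (B 1 - A 1) <= 1 * `|B 1 - A 1|.
      apply: (@le_trans _ _ (d * `|B 1 - A 1|)).
        by rewrite (ler_wpM2l (ltW d0))// ler_norm.
      by rewrite ler_wpM2r.
    have x2 : (1 - d) * (B 1 - c 1) <= 1 * `|B 1 - c 1|.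
      apply: (@le_trans _ _ ((1 - d) * `|B 1 - c 1|)).
        by rewrite ler_wpM2l ?ler_norm//; lra.
      by rewrite ler_wpM2r//; lra.
    by rewrite (ler_wpM2l (ltW d0))// /W0; lra.
  rewrite /L; lra.
have K0 : 0 <= K by rewrite addr_ge0// ltW.
suff : 2 * (1 - s0) * L - 4 * K <= 0 by lra.
(* [V] collects the coefficients of [d] in the expansion of [main]; [5 * K] comes from
   [(2 + d) ^+ 2 <= 4 + 5 * d] for [d <= 1]. *)
pose V := 5 * K + 2 * (1 - s0) * (W0 + `|L| / s0).
apply: (@small_multiples_le0 _ _ V sN) => M hM.
have := main M _ hM erefl; set d := _^-1.
have d0 : 0 < d by rewrite invr_gt0.
have ds0 : d < s0 by rewrite sNs0.
have W00 : 0 <= W0 by rewrite addr_ge0// mulr_ge0.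
have sL : L / s0 <= `|L| / s0 by rewrite ler_wpM2r ?ler_norm// invr_ge0 ltW.
rewrite -subr_ge0 => m; rewrite -subr_ge0.
apply: (le_trans m); rewrite -subr_ge0.
have -> : d * V - (2 * (1 - s0) * L - 4 * K) -
    (K * (2 + d) ^+ 2 - (L - d * W0) * (2 * (1 - s0) * (1 - d / s0))) =
    d * (K * (1 - d) + 2 * (1 - s0) * ((`|L| / s0 - L / s0) + d * W0 / s0)).
  by rewrite /V; field; rewrite gt_eqF.
apply: mulr_ge0; first exact: ltW.
have d1 : d < 1 by apply: lt_trans s01.
apply: addr_ge0; first by apply: mulr_ge0 => //; lra.
apply: mulr_ge0; first by lra.
by rewrite addr_ge0 ?subr_ge0// divr_ge0 ?(ltW s00)// mulr_ge0// ltW.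
Qed.

(** * Soft-min potentials *)

(** Only a directional derivative of [f] is given, so everything is restricted to the line
    [h *: v + x], where the one-variable chain rule applies. *)
Lemma is_derive_comp_real (R : realType) (V : normedModType R) (f : V -> R)
    (g : R -> R) (x v : V) (df dg : R) :
  is_derive x v f df -> is_derive (f x) 1 g dg ->
  is_derive x v (g \o f) (dg * df).
Proof.
move=> hf hg.
pose line (h : R) := h *: v + x.
have lineE (k : V -> R) :
    (fun h => h^-1 *: ((k \o line \o shift 0) (h *: 1) - (k \o line) 0)) =
    (fun h : R => h^-1 *: ((k \o shift x) (h *: v) - k x)).
  by apply/funext => h /=; rewrite /line /shift/= addr0 scale0r add0r [h%:A]mulr1.
have line_derive (k : V -> R) dk :
    is_derive x v k dk <-> is_derive (0 : R) 1 (k \o line) dk.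
  split=> -[kd kv]; split.
  - by rewrite /derivable lineE.
  - by rewrite /derive lineE.
  - by move: kd; rewrite /derivable lineE.
  - by move: kv; rewrite /derive lineE.
apply/line_derive; rewrite -[g \o f \o line]/(g \o (f \o line)).
have f0 : is_derive (0 : R) 1 (f \o line) df by apply/line_derive.
have fl0 : (f \o line) 0 = f x by rewrite /line/= scale0r add0r.
have gd : derivable g ((f \o line) 0) 1 by rewrite fl0; case: hg.
have fd : derivable (f \o line) 0 1 by case: f0.
apply: DeriveDef.
  apply/derivable1_diffP/differentiable_comp; exact/derivable1_diffP.
rewrite -derive1E derive1_comp// !derive1E fl0.
by case: hg => _ ->; case: f0 => _ ->.
Qed.

Lemma is_derive_coord (R : realType) (d : nat) (x : 'rV[R]_d) (i k : 'I_d) :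
  is_derive x (delta_mx ord0 i) (fun z : 'rV[R]_d => z ord0 k) (k == i)%:R.
Proof.
have lin : (fun h : R => h^-1 *: (((fun z : 'rV[R]_d => z ord0 k) \o shift x)
   (h *: delta_mx ord0 i) - x ord0 k)) @ 0^' --> ((k == i)%:R : R).
  apply/cvgrPdist_lt => e e0; near=> h.
  rewrite /= !mxE eqxx/= addrK [_ *: _]mulrA mulVf ?mul1r ?subrr ?normr0//.
  by near: h; exact: nbhs_dnbhs_neq.
apply: DeriveDef; first by apply/cvg_ex; eexists; exact: lin.
exact/cvg_lim.
Unshelve. all: by end_near. Qed.

(** A class closed under partial derivatives contains all iterated ones, so continuity and
    derivability need only be checked on the class. *)
Lemma closed_smooth (R : realType) (d : nat) (F : set ('rV[R]_d -> R)) :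
  (forall f, F f -> continuous f) ->
  (forall f (i : 'I_d) x, F f -> derivable f x (delta_mx ord0 i)) ->
  (forall f i, F f -> F (partial i f)) ->
  forall f, F f -> smooth f.
Proof.
move=> Fc Fd Fp f Ff s.
have {Ff} : F (foldr (@partial R d) f s) by elim: s => //= i s /Fp.
by split; [exact: Fc|move=> i x; exact: Fd].
Qed.

Section softmin.
Context (R : realType) (d n : nat) (eps : R) (f : 'I_n -> R) (y : 'I_n -> 'rV[R]_d).
Local Notation V := 'rV[R]_d.

(** [tau] is the inverse of the time [s]; this makes the exponent affine in [tau] and admits
    [tau = 0]. *)
Definition boltzmann (tau : R) (j : 'I_n) (x : V) : R :=
  expR (- (f j + tau / 2 * sqnorm2 (x - y j)) / eps).

Definition partition_function (tau : R) (x : V) : R := \sum_j boltzmann tau j x.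

Definition softmin (tau : R) (x : V) : R :=
  eps * (ln n%:R - ln (partition_function tau x)).

(** The normalised Boltzmann weights, written as one exponential so that their derivatives and
    continuity come from those of the exponent. *)
Definition gibbs (tau : R) (j : 'I_n) (x : V) : R :=
  expR (- (f j + tau / 2 * sqnorm2 (x - y j)) / eps - ln (partition_function tau x)).

Hypotheses (n0 : (0 < n)%N) (eps0 : 0 < eps).

Lemma partition_function_gt0 tau x : 0 < partition_function tau x.
Proof.
rewrite /partition_function (bigD1 (Ordinal n0))//=.
by rewrite ltr_pwDl ?expR_gt0// sumr_ge0// => j _; exact: expR_ge0.
Qed.

Lemma gibbsE tau j x : gibbs tau j x = boltzmann tau j x / partition_function tau x.
Proof. by rewrite /gibbs expRB lnK// posrE partition_function_gt0. Qed.

Lemma gibbs_ge0 tau j x : 0 <= gibbs tau j x.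
Proof. exact: expR_ge0. Qed.

Lemma sum_gibbs tau x : \sum_j gibbs tau j x = 1.
Proof.
under eq_bigr do rewrite gibbsE; rewrite -mulr_suml divff// gt_eqF//.
exact: partition_function_gt0.
Qed.

(** The derivative in direction [i] of the exponent of [boltzmann tau j]. *)
Let slope tau j (i : 'I_d) (x : V) := - (tau / eps) * (x ord0 i - y j ord0 i).

Lemma is_derive_sqnorm2 (a x : V) i :
  is_derive x (delta_mx ord0 i) (fun z => sqnorm2 (z - a)) (2 * (x ord0 i - a ord0 i)).
Proof.
have -> : (fun z : V => sqnorm2 (z - a)) =
    \sum_(k < d) ((fun z : V => z ord0 k) - cst (a ord0 k)) ^+ 2.
  apply/funext => z; rewrite /sqnorm2 fct_sumE; apply: eq_bigr => k _.
  by rewrite !mxE.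
apply: is_derive_eq.
  apply: is_derive_sum => k; apply: is_deriveX; apply: is_deriveB.
  exact: is_derive_coord.
rewrite (bigD1 i)//= big1 ?addr0 => [|k /negbTE ki].
  by rewrite eqxx subr0 expr1 [LHS]mulr1.
by rewrite ki subr0 scaler0.
Qed.

Let is_derive_exponent tau j (x : V) i : is_derive x (delta_mx ord0 i)
  (fun z => - (f j + tau / 2 * sqnorm2 (z - y j)) / eps) (slope tau j i x).
Proof.
have -> : (fun z => - (f j + tau / 2 * sqnorm2 (z - y j)) / eps) =
   cst (- f j / eps) + (- tau / 2 / eps) \*: (fun z => sqnorm2 (z - y j)).
  by apply/funext => z; rewrite !fctE /= /cst /GRing.scale/=; field; rewrite gt_eqF.
apply: is_derive_eq.
  by apply: is_deriveD; apply: is_deriveZ; exact: is_derive_sqnorm2.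
by rewrite add0r /slope /GRing.scale/=; field; rewrite gt_eqF.
Qed.

Let is_derive_ln_partition tau (x : V) i : is_derive x (delta_mx ord0 i)
  (fun z => ln (partition_function tau z)) (\sum_j gibbs tau j x * slope tau j i x).
Proof.
have dZ : is_derive x (delta_mx ord0 i) (partition_function tau)
    (\sum_j boltzmann tau j x * slope tau j i x).
  have -> : partition_function tau = \sum_j boltzmann tau j.
    by apply/funext => z; rewrite fct_sumE.
  apply: is_derive_sum => j; rewrite /boltzmann.
  exact: (is_derive_comp_real (is_derive_exponent tau j x i) (is_derive_expR _)).
apply: is_derive_eq.
  exact: (is_derive_comp_real dZ (is_derive1_ln (partition_function_gt0 tau x))).
rewrite mulr_sumr; apply: eq_bigr => j _.
by rewrite gibbsE mulrA [_^-1 * _]mulrC.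
Qed.

Let is_derive_gibbs tau j (x : V) i : is_derive x (delta_mx ord0 i) (gibbs tau j)
  (gibbs tau j x * (slope tau j i x - \sum_k gibbs tau k x * slope tau k i x)).
Proof.
exact: (is_derive_comp_real (is_deriveB (is_derive_exponent tau j x i)
  (is_derive_ln_partition tau x i)) (is_derive_expR _)).
Qed.

Lemma is_derive_softmin tau (x : V) i : is_derive x (delta_mx ord0 i) (softmin tau)
  (tau * \sum_j gibbs tau j x * (x ord0 i - y j ord0 i)).
Proof.
have -> : softmin tau = eps \*: (cst (ln n%:R) - (fun z => ln (partition_function tau z))).
  by [].
apply: is_derive_eq.
  apply: is_deriveZ; apply: is_deriveB; exact: is_derive_ln_partition.
rewrite sub0r /GRing.scale/= mulrN mulr_sumr -sumrN mulr_sumr.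
by apply: eq_bigr => j _; rewrite /slope; field; rewrite gt_eqF.
Qed.

(* Closed under partial derivatives, which gives smoothness to all orders. *)
Inductive gibbs_algebra (tau : R) : set (V -> R) :=
| gibbs_algebra_cst c : gibbs_algebra tau (cst c)
| gibbs_algebra_coord i : gibbs_algebra tau (fun x => x ord0 i)
| gibbs_algebra_gibbs j : gibbs_algebra tau (gibbs tau j)
| gibbs_algebra_add g h : gibbs_algebra tau g -> gibbs_algebra tau h ->
    gibbs_algebra tau (g + h)
| gibbs_algebra_mul g h : gibbs_algebra tau g -> gibbs_algebra tau h ->
    gibbs_algebra tau (g * h).

Lemma gibbs_algebra_sum tau m (g : 'I_m -> V -> R) :
  (forall i, gibbs_algebra tau (g i)) -> gibbs_algebra tau (\sum_i g i).
Proof.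
by move=> hg; elim/big_ind : _ => //; [exact: gibbs_algebra_cst|exact: gibbs_algebra_add].
Qed.

Lemma gibbs_algebra_derive tau g i : gibbs_algebra tau g ->
  exists2 dg, gibbs_algebra tau dg & forall x, is_derive x (delta_mx ord0 i) g (dg x).
Proof.
have slopeA j : gibbs_algebra tau (slope tau j i).
  have -> : slope tau j i =
      cst (- (tau / eps)) * ((fun x => x ord0 i) + cst (- y j ord0 i)) by [].
  by do !constructor.
elim=> [c|k|j|g1 g2 _ [dg1 A1 D1] _ [dg2 A2 D2]|g1 g2 G1 [dg1 A1 D1] G2 [dg2 A2 D2]].
- by exists (cst 0) => [|x]; [constructor|exact: is_derive_cst].
- exists (cst (k == i)%:R) => [|x]; [constructor|exact: is_derive_coord].
- exists (gibbs tau j * (slope tau j i +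
      cst (-1) * \sum_k gibbs tau k * slope tau k i)) => [|x].
    apply: gibbs_algebra_mul; first exact: gibbs_algebra_gibbs.
    apply: gibbs_algebra_add => //; apply: gibbs_algebra_mul; first by constructor.
    apply: gibbs_algebra_sum => k; apply: gibbs_algebra_mul => //.
    exact: gibbs_algebra_gibbs.
  apply: is_derive_eq; first exact: is_derive_gibbs.
  by rewrite !fctE fct_sumE mulN1r.
- exists (dg1 + dg2) => [|x]; first exact: gibbs_algebra_add.
  exact: is_deriveD.
- exists (g1 * dg2 + g2 * dg1) => [|x].
    by apply: gibbs_algebra_add; exact: gibbs_algebra_mul.
  exact: is_deriveM.
Qed.

Let ctsD (g h : V -> R) : continuous g -> continuous h ->
  continuous (fun x => g x + h x).
Proof. by move=> cg ch x; apply: (@continuousD R _ V g h x); [exact: cg|exact: ch]. Qed.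

Let ctsM (g h : V -> R) : continuous g -> continuous h ->
  continuous (fun x => g x * h x).
Proof. by move=> cg ch x; apply: (@continuousM R V g h x); [exact: cg|exact: ch]. Qed.

Let cts_cst (c : R) : continuous (fun _ : V => c).
Proof. by move=> x; exact: cst_continuous. Qed.

Let ctsN (g : V -> R) : continuous g -> continuous (fun x => - g x).
Proof. by move=> cg x; apply: (@continuousN R _ V g x); exact: cg. Qed.

Let cts_sum m (g : 'I_m -> V -> R) :
  (forall i, continuous (g i)) -> continuous (fun x => \sum_i g i x).
Proof.
move=> cg; rewrite (_ : (fun x => _) = \sum_i g i); last first.
  by apply/funext => x; rewrite fct_sumE.
elim/big_ind : _ => //; first exact: cts_cst.
Qed.

Lemma continuous_sqnorm2 (a : V) : continuous (fun z : V => sqnorm2 (z - a)).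
Proof.
apply: cts_sum => k.
have c : continuous (fun z : V => (z - a) ord0 k).
  under eq_fun do rewrite !mxE.
  by apply: ctsD; [exact: coord_continuous|exact: cts_cst].
exact: (ctsM c c).
Qed.

Lemma continuous_exponent tau j :
  continuous (fun z : V => - (f j + tau / 2 * sqnorm2 (z - y j)) / eps).
Proof.
apply: ctsM; last exact: cts_cst.
apply: ctsN; apply: ctsD; first exact: cts_cst.
apply: ctsM; [exact: cts_cst|exact: continuous_sqnorm2].
Qed.

Lemma continuous_ln_partition tau :
  continuous (fun x => ln (partition_function tau x)).
Proof.
move=> x; apply: (@continuous_comp _ _ _ (partition_function tau) (@ln R)); last first.
  by apply: continuous_ln; exact: partition_function_gt0.
move: x; apply: cts_sum => j z.
apply: (@continuous_comp _ _ _ (fun z : V =>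
  - (f j + tau / 2 * sqnorm2 (z - y j)) / eps) (@expR R)).
  exact: continuous_exponent.
exact: continuous_expR.
Qed.

Lemma gibbs_algebra_continuous tau g : gibbs_algebra tau g -> continuous g.
Proof.
elim=> [c|k|j|g1 g2 _ c1 _ c2|g1 g2 _ c1 _ c2].
- exact: cts_cst.
- exact: coord_continuous.
- move=> x; apply: (@continuous_comp _ _ _ (fun z : V =>
    - (f j + tau / 2 * sqnorm2 (z - y j)) / eps - ln (partition_function tau z))
    (@expR R)); last exact: continuous_expR.
  move: x; apply: ctsD; first exact: continuous_exponent.
  exact/ctsN/continuous_ln_partition.
- exact: ctsD.
- exact: ctsM.
Qed.

(** The logarithm is not among the constructors of [gibbs_algebra], but the first partial
    derivatives of [softmin] lie in that algebra, so adjoining this one function keeps the class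
    closed. *)
Lemma softmin_smooth tau : smooth (softmin tau).
Proof.
apply: (@closed_smooth _ _ [set g | g = softmin tau \/ gibbs_algebra tau g]); last by left.
- move=> g [->|]; last exact: gibbs_algebra_continuous.
  apply: ctsM; first exact: cts_cst.
  apply: ctsD; first exact: cts_cst.
  exact/ctsN/continuous_ln_partition.
- move=> g i x [->|/(gibbs_algebra_derive i)[dg _ gdg]].
    by case: (is_derive_softmin tau x i).
  by case: (gdg x).
- move=> g i [->|/(gibbs_algebra_derive i)[dg Adg gdg]]; right.
    have -> : partial i (softmin tau) =
       cst tau * \sum_j gibbs tau j * ((fun x => x ord0 i) + cst (- y j ord0 i)).
      apply/funext => x; rewrite /partial.
      have [_ ->] := is_derive_softmin tau x i.
      by rewrite !fctE fct_sumE.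
    apply: gibbs_algebra_mul; first by constructor.
    by apply: gibbs_algebra_sum => j; do !constructor.
  rewrite (_ : partial i g = dg)//; apply/funext => x.
  by have [_] := gdg x.
Qed.

(** The gradient is [tau] times the Gibbs mean of [x - y j]; coordinatewise, the square of a mean is
    at most the mean of the squares. *)
Lemma sqnorm2_grad_softmin tau x :
  sqnorm2 (gradient (softmin tau) x) <=
  tau ^+ 2 * \sum_j gibbs tau j x * sqnorm2 (x - y j).
Proof.
have -> : \sum_j gibbs tau j x * sqnorm2 (x - y j) =
    \sum_(i < d) \sum_j gibbs tau j x * (x ord0 i - y j ord0 i) ^+ 2.
  rewrite exchange_big/=; apply: eq_bigr => j _; rewrite /sqnorm2 mulr_sumr.
  by apply: eq_bigr => i _; rewrite !mxE.
rewrite mulr_sumr; apply: ler_sum => i _; rewrite mxE /partial.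
have [_ ->] := is_derive_softmin tau x i.
rewrite exprMn ler_wpM2l ?sqr_ge0//.
set m := \sum_j _.
have : 0 <= \sum_j gibbs tau j x * (x ord0 i - y j ord0 i - m) ^+ 2.
  by apply: sumr_ge0 => j _; rewrite mulr_ge0 ?gibbs_ge0 ?sqr_ge0.
have -> (a : R) : \sum_j gibbs tau j x * (x ord0 i - y j ord0 i - a) ^+ 2 =
   \sum_j gibbs tau j x * (x ord0 i - y j ord0 i) ^+ 2 +
   ((- 2 * a) * \sum_j gibbs tau j x * (x ord0 i - y j ord0 i) +
    a ^+ 2 * \sum_j gibbs tau j x).
  by rewrite !mulr_sumr -!big_split/=; apply: eq_bigr => j _; ring.
rewrite sum_gibbs -/m; lra.
Qed.

(* Jensen's inequality for [exp] and the Gibbs weights at [tau]. *)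
Lemma softmin_time_step tau tau' x :
  softmin tau' x <= softmin tau x -
    (tau - tau') / 2 * \sum_j gibbs tau j x * sqnorm2 (x - y j).
Proof.
set S := \sum_j _; pose k := (tau - tau') / 2 / eps.
have ZE : partition_function tau' x =
    partition_function tau x *
    \sum_j gibbs tau j x * expR (k * sqnorm2 (x - y j)).
  rewrite mulr_sumr; apply: eq_bigr => j _.
  rewrite gibbsE mulrA mulrCA divff ?mulr1 ?gt_eqF ?partition_function_gt0//.
  rewrite -expRD; congr expR; rewrite /k; field; by rewrite gt_eqF.
have jensen : expR (k * S) <= \sum_j gibbs tau j x * expR (k * sqnorm2 (x - y j)).
  apply: (@le_trans _ _ (\sum_j gibbs tau j x *
      (expR (k * S) * (1 + (k * sqnorm2 (x - y j) - k * S))))).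
    have -> (a b : R) : \sum_j gibbs tau j x *
        (a * (1 + (k * sqnorm2 (x - y j) - b))) =
        a * (1 - b) * (\sum_j gibbs tau j x) +
        a * k * \sum_j gibbs tau j x * sqnorm2 (x - y j).
      by rewrite !mulr_sumr -big_split/=; apply: eq_bigr => j _; ring.
    by rewrite sum_gibbs -/S; lra.
  apply: ler_sum => j _; rewrite ler_wpM2l ?gibbs_ge0//.
  rewrite -ler_pdivlMl ?expR_gt0// -expRN -expRD.
  apply: le_trans (expR_ge1Dx _) _; rewrite ler_expR; lra.
have : ln (partition_function tau' x) >= ln (partition_function tau x) + k * S.
  rewrite ZE lnM ?posrE ?partition_function_gt0//; last first.
    by apply: lt_le_trans jensen; exact: expR_gt0.
  rewrite lerD2l -[leLHS]expRK ler_ln ?posrE ?expR_gt0//.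
  by apply: lt_le_trans jensen; exact: expR_gt0.
have -> : (tau - tau') / 2 * S = eps * (k * S).
  by rewrite /k; field; rewrite gt_eqF.
move=> h; have := ler_wpM2l (ltW eps0) h; rewrite /softmin; lra.
Qed.

(** Keeping one term of the partition function loses only the normalisation by [n], hence the error
    [eps * ln n%:R]. *)
Lemma softmin_le tau x j :
  softmin tau x <= f j + tau / 2 * sqnorm2 (x - y j) + eps * ln n%:R.
Proof.
have : - (f j + tau / 2 * sqnorm2 (x - y j)) / eps <= ln (partition_function tau x).
  rewrite -[leLHS]expRK ler_ln ?posrE ?expR_gt0 ?partition_function_gt0//.
  rewrite /partition_function (bigD1 j)//= lerDl sumr_ge0// => k _.
  exact: expR_ge0.
rewrite ler_pdivrMr// /softmin; lra.
Qed.

(** The partition function is a sum of [n] terms, each at most [expR (- a / eps)]; the normalisation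
    cancels the [n], so no error arises on this side. *)
Lemma le_softmin tau x (a : R) :
  (forall j, a <= f j + tau / 2 * sqnorm2 (x - y j)) -> a <= softmin tau x.
Proof.
move=> af.
have n0R : 0 < n%:R :> R by rewrite ltr0n.
have : ln (partition_function tau x) <= ln n%:R - a / eps.
  rewrite -[a / eps]opprK -mulNr -[- a / eps]expRK opprK -lnM ?posrE ?expR_gt0//.
  rewrite ler_ln ?posrE ?partition_function_gt0 ?mulr_gt0 ?expR_gt0//.
  rewrite -[X in X%:R * _]card_ord mulr_natl -sumr_const; apply: ler_sum => j _.
  by rewrite ler_expR ler_pM2r ?invr_gt0// lerN2.
rewrite lerBrDr -lerBrDl ler_pdivrMr// /softmin; lra.
Qed.
End softmin.

(** * Dominated measures and the common part *)

Section dominated_measure.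
Context (dT : measure_display) (T : measurableType dT) (R : realType).
Context (mu : probability T R) (sg : {measure set T -> \bar R}).
Hypothesis sg_mu : forall A, measurable A -> (sg A <= mu A)%E.

Lemma integrable_dominated (f : T -> \bar R) :
  mu.-integrable setT f -> sg.-integrable setT f.
Proof.
move=> /integrableP[mf fi]; apply/integrableP; split=> //.
apply: le_lt_trans fi; apply: (ge0_le_measure_integral sg_mu) => //.
by apply: measurableT_comp.
Qed.

Lemma Rintegral_dominated (f : T -> R) : mu.-integrable setT (EFin \o f) ->
  (forall x, 0 <= f x) -> \int[sg]_x f x <= \int[mu]_x f x.
Proof.
move=> fi f0; rewrite /Rintegral fine_le//.
- exact/(integrable_fin_num measurableT)/integrable_dominated.
- exact: (integrable_fin_num measurableT).
- by apply: (ge0_le_measure_integral sg_mu) => //; case/integrableP: fi.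
Qed.

Lemma integrable_cst_prob (c : R) : mu.-integrable setT (EFin \o (fun=> c)).
Proof. exact: finite_measure_integrable_cst. Qed.

Lemma integrable_addZ (f g : T -> R) (a b : R) :
  mu.-integrable setT (EFin \o f) -> mu.-integrable setT (EFin \o g) ->
  mu.-integrable setT (EFin \o (fun x => a * f x + b * g x)).
Proof.
move=> fi gi; rewrite (_ : _ \o _ = (fun x => (a%:E * (f x)%:E) + (b%:E * (g x)%:E))%E).
  by apply: integrableD => //; apply: integrableZl.
by apply/funext => x /=; rewrite EFinD !EFinM.
Qed.

Lemma dominated_mass_le1 : fine (sg setT) <= 1.
Proof.
have sg1 : (sg setT <= 1)%E by rewrite -(probability_setT mu) sg_mu.
rewrite -lee_fin fineK// ge0_fin_numE//.
exact: le_lt_trans sg1 (ltry _).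
Qed.

(** [X] is the integral of [g - A] under [sg] and, up to sign, under [mu - sg]. Cauchy-Schwarz under
    both, with masses [S] and [1 - S], gives [X ^+ 2 / S + X ^+ 2 / (1 - S) <= W]. For [mu - sg] it
    is obtained by optimising over a shift [k], so that this difference is never formed as a
    measure. *)
Lemma dominated_mean_variance (g : T -> R) :
  let A := \int[mu]_x g x in let S := fine (sg setT) in
  mu.-integrable setT (EFin \o g) ->
  mu.-integrable setT (EFin \o (fun x => (g x - A) ^+ 2)) -> 0 < S ->
  (\int[sg]_x g x - S * A) ^+ 2 <= S * (1 - S) * \int[mu]_x (g x - A) ^+ 2.
Proof.
move=> A S gi vi S0; set X := \int[sg]_x g x - S * A.
set W := \int[mu]_x (g x - A) ^+ 2.
have ci c := integrable_cst_prob c.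
have qi : mu.-integrable setT (EFin \o (fun x => g x - A)).
  have := integrable_addZ 1 (-1) gi (ci A).
  by apply: eq_integrable => // x _ /=; rewrite mul1r mulN1r.
have split_int (m : {measure set T -> \bar R}) (k : R) :
    (forall f, mu.-integrable setT f -> m.-integrable setT f) ->
    \int[m]_x (g x - A - k) ^+ 2 = \int[m]_x (g x - A) ^+ 2
      + ((- (2 * k)) * \int[m]_x (g x - A) + k ^+ 2 * fine (m setT)).
  move=> im; rewrite -Rintegral_cst// -RintegralZl//; last exact: im.
  rewrite -RintegralD//; last 2 first.
  - have := integrable_addZ (- (2 * k)) 0 qi qi => /im.
    by apply: eq_integrable => // x _ /=; rewrite mul0r addr0.
  - exact: im.
  rewrite -RintegralD//; last 2 first.
  - exact: im.
  - have := integrable_addZ (- (2 * k)) (k ^+ 2) qi (ci 1) => /im.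
    by apply: eq_integrable => // x _ /=; rewrite mulr1.
  by apply: eq_Rintegral => x _; ring.
have mean (m : {measure set T -> \bar R}) :
    (forall f, mu.-integrable setT f -> m.-integrable setT f) ->
    \int[m]_x (g x - A) = \int[m]_x g x - A * fine (m setT).
  by move=> im; rewrite RintegralB// ?Rintegral_cst//; exact: im.
have idm f : mu.-integrable setT f -> mu.-integrable setT f by [].
have mu1 : fine (mu setT) = 1 by rewrite probability_setT.
have shifti k : mu.-integrable setT (EFin \o (fun x => (g x - A - k) ^+ 2)).
  have := integrable_addZ 1 1 vi (@idm _ _).
  move=> /(_ _ (integrable_addZ (- (2 * k)) (k ^+ 2) qi (ci 1))).
  by apply: eq_integrable => // x _ /=; congr EFin; ring.
(* The integral of [(g - A - k) ^+ 2] under [mu - sg] is nonnegative; here it is expanded in [k]. *)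
have key k : \int[sg]_x (g x - A) ^+ 2 - 2 * k * X + k ^+ 2 * S <= W + k ^+ 2.
  have := Rintegral_dominated (shifti k) (fun x => sqr_ge0 _).
  rewrite (split_int sg _ integrable_dominated) (split_int mu _ idm).
  rewrite (mean sg integrable_dominated) (mean mu idm) mu1 -/A -/S -/W -/X.
  by rewrite [A * S]mulrC -/X; lra.
(* Cauchy-Schwarz under [sg], from the shift [X / S]. *)
have cs : 0 <= \int[sg]_x (g x - A) ^+ 2 - X ^+ 2 / S.
  have : 0 <= \int[sg]_x (g x - A - X / S) ^+ 2.
    by apply: Rintegral_ge0 => x _; exact: sqr_ge0.
  rewrite (split_int sg _ integrable_dominated) (mean sg integrable_dominated).
  rewrite -/S [A * S]mulrC -/X.
  have -> : - (2 * (X / S)) * X + (X / S) ^+ 2 * S = - (X ^+ 2 / S).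
    by field; rewrite gt_eqF.
  by [].
have {}key k : X ^+ 2 / S - 2 * k * X + k ^+ 2 * S <= W + k ^+ 2.
  by have := key k; lra.
have S1 : S <= 1 by exact: dominated_mass_le1.
have W0 : 0 <= W by apply: Rintegral_ge0 => x _; exact: sqr_ge0.
(* At full mass [key] is affine in [k], which forces [X = 0]: otherwise the [k] chosen below would
   give [X ^+ 2 + 2 * (W + 1) <= W]. *)
have [S1'|S1'] := eqVneq S 1.
  rewrite S1' subrr mulr0 mul0r.
  have [->|X0] := eqVneq X 0; first by rewrite expr0n.
  have := key (- (W + 1) / X); rewrite S1' mulr1 divr1.
  have -> : 2 * (- (W + 1) / X) * X = - (2 * (W + 1)) by field.
  by have := sqr_ge0 X; lra.
have {}S1 : 0 < 1 - S by rewrite subr_gt0 lt_neqAle S1'.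
(* The shift at which [key] is sharpest. *)
have := key (- X / (1 - S)); rewrite -[_ <= W + _]subr_ge0 => h.
rewrite -subr_ge0.
have -> : S * (1 - S) * W - X ^+ 2 = S * (1 - S) * (W + (- X / (1 - S)) ^+ 2 -
   (X ^+ 2 / S - 2 * (- X / (1 - S)) * X + (- X / (1 - S)) ^+ 2 * S)).
  by field; rewrite !gt_eqF.
by apply: mulr_ge0 => //; apply: mulr_ge0; exact: ltW.
Qed.

End dominated_measure.

(** Given a Hahn decomposition [P], [N] of [mu - nu], take [nu] on [P] and [mu] on [N]. The mass is
    [nu P + mu N], and its stated form is what total variation bounds from below. *)
Lemma common_part (dT : measure_display) (T : measurableType dT) (R : realType)
    (mu nu : probability T R) :
  exists sg : {measure set T -> \bar R},
    [/\ forall A, measurable A -> (sg A <= mu A)%E,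
        forall A, measurable A -> (sg A <= nu A)%E &
        exists2 P, measurable P & (sg setT = 1 - (mu P - nu P))%E].
Proof.
pose chi := cadd (charge_of_finite_measure mu) (copp (charge_of_finite_measure nu)).
have [P [N [[mP Ppos] [mN Nneg] PN1 PN0]]] := Hahn_decomposition chi.
have munu A : measurable A -> A `<=` P -> (nu A <= mu A)%E.
  move=> mA AP; have : (0 <= mu A - nu A)%E := Ppos A mA AP.
  rewrite sube_ge0//.
  by rewrite fin_num_measure// orbT.
have numu A : measurable A -> A `<=` N -> (mu A <= nu A)%E.
  move=> mA AN; have : (mu A - nu A <= 0)%E := Nneg A mA AN.
  by rewrite sube_le0.
have splitPN (m : {measure set T -> \bar R}) A : measurable A ->
    m A = (m (A `&` P) + m (A `&` N))%E.
  move=> mA; rewrite -measureU//; [|exact: measurableI|exact: measurableI|].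
    by rewrite -setIUr PN1 setIT.
  by rewrite setIACA PN0 setI0.
pose sg : {measure set T -> \bar R} := measure_add (mrestr nu mP) (mrestr mu mN).
have sgE A : sg A = (nu (A `&` P) + mu (A `&` N))%E.
  exact: measure_addE.
exists sg; split=> [A mA|A mA|].
- rewrite sgE (splitPN mu A mA) leeD2r//.
  by apply: munu; [exact: measurableI|exact: subIsetr].
- rewrite sgE (splitPN nu A mA) leeD2l//.
  by apply: numu; [exact: measurableI|exact: subIsetr].
- exists P => //; rewrite sgE !setTI.
  have : (mu P + mu N = 1)%E.
    by rewrite -(probability_setT mu) (splitPN mu setT)// !setTI.
  have /fineK <- : mu P \is a fin_num by exact: fin_num_measure.
  have /fineK <- : mu N \is a fin_num by exact: fin_num_measure.
  have /fineK <- : nu P \is a fin_num by exact: fin_num_measure.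
  rewrite -!EFinD => -[<-]; congr EFin; ring.
Qed.

(** * Measures on Euclidean space satisfying a Poincare inequality *)

Section euclidean_measure.
Context (R : realType) (d : nat).
Local Notation V := 'rV[R]_d.
Local Notation B := (borel_rV R d).

Lemma continuous_measurable_rV (g : V -> R) : continuous g ->
  measurable_fun setT (g : B -> R).
Proof.
move=> /continuousP cg; apply: (measurability _ (RGenOpens.measurableE R)).
move=> _ [_ [a [b ->] <-]]; rewrite setTI; apply: sub_sigma_algebra.
exact/cg/interval_open.
Qed.

Lemma sqnorm2_ge0 (x : V) : 0 <= sqnorm2 x.
Proof. by apply: sumr_ge0 => i _; exact: sqr_ge0. Qed.

(** The difference of the two sides is [a^-1] times the squared norm of [a *: x - z]. *)
Lemma sqnorm2D (x z : V) (a : R) : 0 < a ->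
  sqnorm2 (x + z) <= (1 + a) * sqnorm2 x + (1 + a^-1) * sqnorm2 z.
Proof.
move=> a0; rewrite /sqnorm2 !mulr_sumr -big_split/=; apply: ler_sum => i _.
rewrite mxE -subr_ge0.
have -> : (1 + a) * x ord0 i ^+ 2 + (1 + a^-1) * z ord0 i ^+ 2 -
    (x ord0 i + z ord0 i) ^+ 2 = a^-1 * (a * x ord0 i - z ord0 i) ^+ 2.
  by field; rewrite gt_eqF.
by rewrite mulr_ge0 ?sqr_ge0// invr_ge0 ltW.
Qed.

Lemma smooth_coord (i : 'I_d) : smooth (fun x : V => x ord0 i).
Proof.
apply: (@closed_smooth _ _ [set f | f = (fun x : V => x ord0 i) \/ exists c, f = cst c]).
- move=> f [->|[c ->]]; first exact: coord_continuous.
  by move=> x; exact: cst_continuous.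
- move=> f k x [->|[c ->]]; first by case: (is_derive_coord x k i).
  by apply: derivable_cst.
- move=> f k [->|[c ->]]; right.
    exists (i == k)%:R; apply/funext => x; rewrite /partial.
    by have [_ ->] := is_derive_coord x k i.
  by exists 0; apply/funext => x; rewrite /partial derive_cst.
- by left.
Qed.

Context (mu : probability B R).

Lemma poincare_variance (C : R) (f : V -> R) : poincare_bound mu C -> smooth f ->
  (\int[mu]_x ((f x - Rintegral mu setT f) ^+ 2)%:E <=
   C%:E * \int[mu]_x (sqnorm2 (gradient f x))%:E)%E.
Proof.
move=> [_ h] /h; rewrite /variance !unlock => /(le_trans _); apply.
by rewrite le_eqVlt; apply/orP; left; apply/eqP; apply: eq_integral => x _ /=.
Qed.

Lemma integrable_le (f g : V -> R) : measurable_fun setT (f : B -> R) ->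
  mu.-integrable setT (EFin \o g) -> (forall x, `|f x| <= g x) ->
  mu.-integrable setT (EFin \o f).
Proof.
move=> mf gi fg; apply: (le_integrable measurableT _ _ gi).
  exact/measurable_EFinP.
by move=> x _ /=; rewrite lee_fin (le_trans (fg x))// ler_norm.
Qed.

Lemma measurable_coord (i : 'I_d) : measurable_fun setT (fun x : B => (x : V) ord0 i).
Proof. by apply: continuous_measurable_rV; exact: coord_continuous. Qed.

Lemma measurable_sqnorm2 (a : V) : measurable_fun setT (fun x : B => sqnorm2 ((x : V) - a)).
Proof. by apply: continuous_measurable_rV; exact: continuous_sqnorm2. Qed.

Lemma gradient_coord (i : 'I_d) (x : V) :
  sqnorm2 (gradient (fun x : V => x ord0 i) x) = 1.
Proof.
rewrite /sqnorm2 (bigD1 i)//= big1 ?addr0 => [|k ki].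
  by rewrite mxE /partial; have [_ ->] := is_derive_coord x i i; rewrite eqxx expr1n.
rewrite mxE /partial; have [_ ->] := is_derive_coord x k i.
by rewrite eq_sym (negbTE ki) expr0n.
Qed.

(** The Poincare inequality for a coordinate function, whose gradient has norm 1, bounds its second
    moment about [m] by [C]. *)
Lemma integrable_sqnorm2 (C : R) (a : V) : poincare_bound mu C ->
  mu.-integrable setT (fun x => (sqnorm2 (x - a))%:E).
Proof.
move=> PC.
have coordi i : mu.-integrable setT (EFin \o (fun x : V => (x ord0 i - a ord0 i) ^+ 2)).
  (* If the coordinate has no finite integral, [m] is a default value; the moment about this centre
     is still bounded, and hence so is the one about [a ord0 i]. *)
  set m := \int[mu]_x (x : V) ord0 i.
  have mcoord c : measurable_fun setT (fun x : B => ((x : V) ord0 i - c) ^+ 2).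
    apply: (measurable_funX 2); apply: measurable_funB => //.
    exact: measurable_coord.
  have ci : mu.-integrable setT (EFin \o (fun x : V => (x ord0 i - m) ^+ 2)).
    apply/integrableP; split; first by apply/measurable_EFinP; exact: (mcoord m).
    apply: (@le_lt_trans _ _ C%:E); last exact: ltry.
    have := poincare_variance PC (smooth_coord i).
    under [X in (_ <= _ * X)%E -> _]eq_integral do rewrite gradient_coord.
    rewrite integral_cst// [X in (1 * X)%E](probability_setT mu) mul1e mule1; apply: le_trans.
    rewrite le_eqVlt; apply/orP; left; apply/eqP; apply: eq_integral => x _ /=.
    by rewrite ger0_norm// sqr_ge0.
  apply: (@integrable_le _ (fun x => 2 * (x ord0 i - m) ^+ 2 + 2 * (m - a ord0 i) ^+ 2)).
  - exact: mcoord.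
  - exact: (integrable_addZ 2 2 ci (integrable_cst_prob mu _)).
  - move=> x; rewrite ger0_norm ?sqr_ge0// -subr_ge0.
    have -> : 2 * (x ord0 i - m) ^+ 2 + 2 * (m - a ord0 i) ^+ 2 -
      (x ord0 i - a ord0 i) ^+ 2 = (x ord0 i + a ord0 i - 2 * m) ^+ 2 by ring.
    exact: sqr_ge0.
have := @integrable_sum _ B R mu setT measurableT 'I_d (index_enum 'I_d) xpredT
  (fun i x => ((x ord0 i - a ord0 i) ^+ 2)%:E).
move=> /(_ (fun i _ => coordi i)).
apply: eq_integrable => // x _; rewrite sumEFin; congr EFin.
by apply: eq_bigr => i _; rewrite !mxE.
Qed.

End euclidean_measure.

(** * The dual gap *)

Section softmin_integrals.
Context (R : realType) (d n : nat) (eps : R) (f : 'I_n -> R) (y : 'I_n -> 'rV[R]_d).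
Hypotheses (n0 : (0 < n)%N) (eps0 : 0 < eps).
Local Notation V := 'rV[R]_d.
Local Notation B := (borel_rV R d).
Local Notation G := (softmin eps f y).
Local Notation energy tau x := (sqnorm2 (gradient (G tau) x)).

Lemma measurable_softmin tau : measurable_fun setT (G tau : B -> R).
Proof.
apply: continuous_measurable_rV.
by have [] := softmin_smooth f y n0 eps0 tau [::].
Qed.

Lemma measurable_energy tau : measurable_fun setT ((fun x => energy tau x) : B -> R).
Proof.
apply: measurable_sum => i; apply: (measurable_funX 2).
rewrite (_ : (fun x => _) = partial i (G tau)); last first.
  by apply/funext => x; rewrite mxE.
apply: continuous_measurable_rV.
by have [] := softmin_smooth f y n0 eps0 tau [:: i].
Qed.

(** Eliminates the Gibbs mean of the squared distance between [sqnorm2_grad_softmin] and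
    [softmin_time_step]. At inverse times it becomes the Hamilton-Jacobi inequality; at [tau' = 0]
    it makes the energy integrable. *)
Lemma energy_le tau tau' x : 0 <= tau -> 0 <= tau' -> tau' <= tau ->
  (tau - tau') / 2 * energy tau x <= tau ^+ 2 * (G tau x - G tau' x).
Proof.
move=> t0 t'0 tt'; have := softmin_time_step f y n0 eps0 tau tau' x.
have := sqnorm2_grad_softmin f y n0 eps0 tau x.
set S := \sum_j _ => h1 h2.
apply: (@le_trans _ _ ((tau - tau') / 2 * (tau ^+ 2 * S))).
  by rewrite ler_wpM2l// divr_ge0// subr_ge0.
by rewrite mulrCA ler_wpM2l ?sqr_ge0//; lra.
Qed.

Lemma softmin_step s s' x : 0 < s -> s < s' ->
  G s'^-1 x <= G s^-1 x - (s' - s) * (s / s') / 2 * energy s^-1 x.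
Proof.
move=> s0 ss'; have s'0 : 0 < s' by apply: lt_trans ss'.
have si : 0 < s^-1 by rewrite invr_gt0.
have s'i : 0 < s'^-1 by rewrite invr_gt0.
have ssi : s'^-1 <= s^-1 by rewrite lef_pV2 ?posrE// ltW.
have := energy_le x (ltW si) (ltW s'i) ssi.
have s20 : 0 < s ^+ 2 by rewrite exprn_gt0.
have ss (D : R) : s ^+ 2 * (s^-1 ^+ 2 * D) = D by field; rewrite gt_eqF.
rewrite -(ler_pM2l s20) ss.
have -> : s ^+ 2 * ((s^-1 - s'^-1) / 2 * energy s^-1 x) =
    (s' - s) * (s / s') / 2 * energy s^-1 x by field; rewrite !gt_eqF.
lra.
Qed.

Section one_measure.
Context (mu : probability B R) (C : R).
Hypothesis PC : poincare_bound mu C.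

(** The soft-min lies between a constant and a quadratic function, and second moments are finite. *)
Lemma integrable_softmin tau : 0 <= tau -> mu.-integrable setT (EFin \o (G tau : B -> R)).
Proof.
move=> t0; pose j0 := Ordinal n0; pose K := \sum_j `|f j|.
apply: (@integrable_le _ _ _ _ (fun x =>
  1 * (2 * K + eps * ln n%:R) + tau / 2 * sqnorm2 (x - y j0))).
- exact: measurable_softmin.
- apply: (integrable_addZ 1 _ (integrable_cst_prob mu _)).
  exact: (integrable_sqnorm2 _ PC).
have fK j : `|f j| <= K by rewrite /K (bigD1 j)//= lerDl sumr_ge0.
have sq0 j x : 0 <= tau / 2 * sqnorm2 (x - y j).
  by rewrite mulr_ge0 ?sqnorm2_ge0// divr_ge0.
have ln0 : 0 <= eps * ln n%:R by rewrite (mulr_ge0 (ltW eps0))// ln_ge0// ler1n.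
move=> x; rewrite ler_norml; apply/andP; split.
  apply: le_softmin => // j; have := fK j; rewrite ler_norml => /andP[].
  have := sq0 j x; have := sq0 j0 x; have := fK j0; have := normr_ge0 (f j0); lra.
apply: (le_trans (softmin_le f y n0 eps0 _ _ j0)).
have := fK j0; have := ler_norm (f j0); have := normr_ge0 (f j0); lra.
Qed.

Lemma integrable_energy tau : 0 < tau ->
  mu.-integrable setT (EFin \o ((fun x => energy tau x) : B -> R)).
Proof.
move=> t0; have t0' := ltW t0.
apply: (@integrable_le _ _ _ _ (fun x => 2 * tau * G tau x + - (2 * tau) * G 0 x)).
- exact: measurable_energy.
- by apply: integrable_addZ; apply: integrable_softmin.
move=> x; rewrite ger0_norm ?sqnorm2_ge0//.
(* The energy is at most [2 * tau * (G tau x - G 0 x)], a difference of integrable functions. *)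
have := @energy_le tau 0 x t0' (lexx _) t0'; rewrite subr0 => h.
have t2 : 0 < tau / 2 by rewrite divr_gt0.
rewrite -(ler_pM2l t2); apply: (le_trans h); rewrite le_eqVlt; apply/orP; left.
by apply/eqP; field.
Qed.

Lemma variance_softmin tau : 0 < tau ->
  let A := \int[mu]_x G tau x in
  mu.-integrable setT (EFin \o ((fun x => (G tau x - A) ^+ 2) : B -> R)) /\
  \int[mu]_x (G tau x - A) ^+ 2 <= C * \int[mu]_x energy tau x.
Proof.
move=> t0 A; have := poincare_variance PC (softmin_smooth f y n0 eps0 tau).
have Ei := integrable_energy t0.
have EE : (\int[mu]_x (energy tau x)%:E = (\int[mu]_x energy tau x)%:E)%E.
  by rewrite fineK//; exact: (integrable_fin_num measurableT Ei).
rewrite EE -EFinM => h.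
have Vi : mu.-integrable setT (EFin \o ((fun x => (G tau x - A) ^+ 2) : B -> R)).
  apply/integrableP; split.
    apply/measurable_EFinP; apply: (measurable_funX 2); apply: measurable_funB => //.
    exact: measurable_softmin.
  apply: le_lt_trans (ltry (C * \int[mu]_x energy tau x)); apply: le_trans h.
  rewrite le_eqVlt; apply/orP; left; apply/eqP; apply: eq_integral => x _ /=.
  by rewrite ger0_norm// sqr_ge0.
split=> //; rewrite -lee_fin fineK//.
exact: (integrable_fin_num measurableT Vi).
Qed.

Lemma mean_softmin_step s s' : 0 < s -> s < s' ->
  \int[mu]_x G s'^-1 x <= \int[mu]_x G s^-1 x -
     (s' - s) * (s / s') / 2 * \int[mu]_x energy s^-1 x.
Proof.
move=> s0 ss'; have s'0 : 0 < s' by apply: lt_trans ss'.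
rewrite -RintegralZl//; last by apply: integrable_energy; rewrite invr_gt0.
have := @integrable_softmin s^-1; rewrite invr_ge0 ltW// => /(_ isT) Gi.
have Ei : mu.-integrable setT (EFin \o ((fun x => energy s^-1 x) : B -> R)).
  by apply: integrable_energy; rewrite invr_gt0.
set k := _ / 2.
rewrite -RintegralB//; last first.
  have := integrable_addZ k 0 Ei Ei.
  by apply: eq_integrable => // x _ /=; rewrite mul0r addr0.
apply: le_Rintegral => //.
- by apply: integrable_softmin; rewrite invr_ge0 ltW.
- have := integrable_addZ 1 (- k) Gi Ei.
  by apply: eq_integrable => // x _ /=; rewrite mul1r mulNr.
- by move=> x _; exact: softmin_step.
Qed.

Context (sg : {measure set B -> \bar R}).
Hypothesis sg_mu : forall A, measurable A -> (sg A <= mu A)%E.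
Let S := fine (sg setT).

(** [dominated_mean_variance] followed by the Poincare inequality gives the factor
    [(1 - S) / S * C]; the hypothesis on [K] says, without a quotient, that [K] is at least this. *)
Lemma mean_gap_energy tau K : 0 < tau -> 0 < S -> (1 - S) * C <= S * K ->
  (\int[mu]_x G tau x - S^-1 * \int[sg]_x G tau x) ^+ 2 <=
    K * \int[mu]_x energy tau x.
Proof.
move=> t0 S0 SK; have [Vi VE] := variance_softmin t0.
have S1 : S <= 1 by exact: dominated_mass_le1 sg_mu.
have := dominated_mean_variance sg_mu (integrable_softmin (ltW t0)) Vi S0.
set a := \int[mu]_x G tau x; set b := \int[sg]_x _; set W := \int[mu]_x (_ ^+ 2).
have -> : (b - S * a) ^+ 2 = S * S * (a - S^-1 * b) ^+ 2.
  by field; rewrite gt_eqF.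
rewrite -!mulrA -/S ler_pM2l// => h; rewrite -(ler_pM2l S0); apply: (le_trans h).
have E0 : 0 <= \int[mu]_x energy tau x.
  by apply: Rintegral_ge0 => x _; exact: sqnorm2_ge0.
apply: (@le_trans _ _ ((1 - S) * (C * \int[mu]_x energy tau x))).
  by rewrite ler_wpM2l// subr_ge0.
by rewrite !mulrA ler_wpM2r.
Qed.

Lemma dominated_mean_decreasing s s' : 0 < s -> s < s' ->
  \int[sg]_x G s'^-1 x <= \int[sg]_x G s^-1 x.
Proof.
move=> s0 ss'; have s'0 : 0 < s' by apply: lt_trans ss'.
apply: le_Rintegral => //.
- by apply: (integrable_dominated sg_mu); apply: integrable_softmin; rewrite invr_ge0 ltW.
- by apply: (integrable_dominated sg_mu); apply: integrable_softmin; rewrite invr_ge0 ltW.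
move=> x _; apply: (le_trans (softmin_step x s0 ss')).
rewrite gerBl mulr_ge0 ?sqnorm2_ge0// divr_ge0// mulr_ge0 ?subr_ge0 ?divr_ge0//; lra.
Qed.

End one_measure.

(** [interpolation_bound] with constants [r * C1] and [r * C2]: as [S >= 1 - t], the ratio
    [(1 - S) / S] is at most [t / (1 - t)]. Strictness in the bound on [r] makes it positive even
    for [t = 0]. *)
Lemma dual_gap (mu nu : probability B R) (C1 C2 r t s0 : R) :
  poincare_bound mu C1 -> poincare_bound nu C2 -> 0 < C1 -> 0 < C2 ->
  TV mu nu = t%:E -> t < 1 -> 0 < s0 < 1 -> t / (1 - t) < r ->
  (1 - s0) * (\int[nu]_x G 1 x - \int[mu]_x G s0^-1 x) <= 2 * r * (C1 + C2).
Proof.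
move=> P1 P2 C10 C20 TVt t1 s01 rt; have /andP[s00 s01'] := s01.
have [sg [sgmu sgnu [P mP sgT]]] := common_part mu nu.
set S := fine (sg setT).
have TVP : (`|mu P - nu P| <= t%:E)%E.
  by rewrite -TVt /TV; apply: ereal_sup_ubound; exists P.
have t0 : 0 <= t by rewrite -lee_fin; exact: le_trans (abse_ge0 _) TVP.
have S_t : 1 - t <= S.
  have muPf : mu P \is a fin_num by exact: fin_num_measure.
  have nuPf : nu P \is a fin_num by exact: fin_num_measure.
  move: TVP; rewrite /S sgT -(fineK muPf) -(fineK nuPf) lee_fin/= => h.
  by rewrite lerD2l lerN2; apply: le_trans h; exact: ler_norm.
have S0 : 0 < S by lra.
have S1 : S <= 1 by exact: dominated_mass_le1 sgmu.
have t1' : 0 < 1 - t by lra.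
have r0 : 0 < r by apply: le_lt_trans rt; rewrite divr_ge0// ltW.
have Sr : 1 - S <= S * r.
  apply: (@le_trans _ _ t); first by lra.
  move: rt; rewrite ltr_pdivrMr// => rt; apply: (le_trans (ltW rt)).
  by rewrite [leRHS]mulrC (ler_wpM2l (ltW r0)).
have SK C : 0 < C -> (1 - S) * C <= S * (r * C).
  by move=> C0; rewrite mulrA ler_wpM2r// ltW.
have := @interpolation_bound _ s0 (r * C1) (r * C2)
  (fun s => \int[mu]_x G s^-1 x) (fun s => \int[nu]_x G s^-1 x)
  (fun s => S^-1 * \int[sg]_x G s^-1 x)
  (fun s => \int[mu]_x energy s^-1 x) (fun s => \int[nu]_x energy s^-1 x) s01.
rewrite invr1 -mulrDr [2 * (r * _)]mulrA; apply.
- exact: mulr_gt0.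
- exact: mulr_gt0.
- by move=> s s' s0s ss' _; apply: (mean_softmin_step P1) => //; lra.
- by move=> s s' s0s ss' _; apply: (mean_softmin_step P2) => //; lra.
- move=> s s' s0s ss' _; rewrite ler_wpM2l ?invr_ge0 ?(ltW S0)//.
  by apply: (dominated_mean_decreasing P1 sgmu) => //; lra.
- move=> s s0s _; apply: (mean_gap_energy P1 sgmu) => //; last exact: SK.
  by rewrite invr_gt0; lra.
- move=> s s0s _; apply: (mean_gap_energy P2 sgnu) => //; last exact: SK.
  by rewrite invr_gt0; lra.
Qed.

End softmin_integrals.

(** * Quantisation by nearest points *)

Section nearest_point.
Context (R : realType) (d : nat) (q : nat -> 'rV[R]_d).
Local Notation V := 'rV[R]_d.
Local Notation B := (borel_rV R d).

(** Ties keep the smaller index. The recursive form lets measurability be proved by induction. *)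
Fixpoint nearest (N : nat) (x : V) : nat :=
  if N is N'.+1 then
    if sqnorm2 (x - q N) < sqnorm2 (x - q (nearest N' x)) then N else nearest N' x
  else 0.

Lemma nearest_ltn N x : (nearest N x < N.+1)%N.
Proof.
elim: N => //= N IH; case: ifP => // _.
exact: (leq_trans IH).
Qed.

Lemma nearest_le N x j : (j <= N)%N -> sqnorm2 (x - q (nearest N x)) <= sqnorm2 (x - q j).
Proof.
elim: N => [|N IH] /=; first by rewrite leqn0 => /eqP ->.
rewrite leq_eqVlt => /predU1P[->|]; first by case: ltP => // /ltW.
by rewrite ltnS => /IH h; case: ltP => // /ltW/le_trans; apply.
Qed.

(** The claims share one induction, because the test that updates the index compares the new
    distance with the least one so far. *)
Lemma measurable_nearest N : measurable_fun setT (nearest N : B -> nat) /\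
  measurable_fun setT ((fun x => sqnorm2 (x - q (nearest N x))) : B -> R).
Proof.
elim: N => [|N [IHk IHm]] /=.
  by split; [exact: measurable_cst|exact: measurable_sqnorm2].
have mb := measurable_fun_ltr (measurable_sqnorm2 (q N.+1)) IHm.
split; first by apply: measurable_fun_ifT => //; exact: measurable_cst.
rewrite (_ : (fun x => _) = (fun x : B => if sqnorm2 ((x : V) - q N.+1) <
     sqnorm2 ((x : V) - q (nearest N x)) then sqnorm2 ((x : V) - q N.+1) else
       sqnorm2 ((x : V) - q (nearest N x)))).
  by apply: measurable_fun_ifT => //; exact: measurable_sqnorm2.
by apply/funext => x; case: ifP.
Qed.

Hypothesis dense_q : forall x e, 0 < e -> exists j, sqnorm2 (x - q j) < e.

(** Dominated convergence: density gives the pointwise limit, and the squared distance to [q 0] is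
    an integrable bound. *)
Lemma nearest_integral_cvg (mu : probability B R) (C : R) : poincare_bound mu C ->
  (\int[mu]_x (sqnorm2 ((x : V) - q (nearest N x)))%:E)%E @[N --> \oo] --> 0%E.
Proof.
move=> PC.
have [] := @dominated_convergence _ B R mu setT measurableT
  (fun N (x : B) => (sqnorm2 ((x : V) - q (nearest N x)))%:E) (cst 0%E)
  (fun x : B => (sqnorm2 ((x : V) - q 0%N))%:E).
- move=> N; apply/measurable_EFinP; exact: (measurable_nearest N).2.
- exact: measurable_cst.
- apply: aeW => x _; apply: cvg_EFin; first by near=> N.
  apply/cvgrPdist_lt => e e0; have [j je] := dense_q x e0.
  near=> N; rewrite sub0r normrN ger0_norm ?sqnorm2_ge0//.
  apply: le_lt_trans je; apply: nearest_le.
  by near: N; exact: nbhs_infty_ge.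
- exact: (integrable_sqnorm2 _ PC).
- apply: aeW => x N _; rewrite /= lee_fin ger0_norm ?sqnorm2_ge0//.
  exact: nearest_le.
by move=> _ _; rewrite integral0.
Unshelve. all: by end_near. Qed.
End nearest_point.

Lemma rational_dense (R : realType) (d : nat) :
  exists q : nat -> 'rV[R]_d, forall x e, 0 < e -> exists j, sqnorm2 (x - q j) < e.
Proof.
exists (fun j => if unpickle j is Some v then map_mx ratr (v : 'rV[rat]_d) else 0).
(* With [d.+1] in place of [d] the tolerance makes sense for [d = 0], and the sum over the
   coordinates is strictly below [e]. *)
move=> x e e0; pose a := e / d.+1%:R.
have a0 : 0 < a by rewrite divr_gt0.
have ex i : exists r : rat, (x ord0 i - ratr r) ^+ 2 < a.
  have sa0 : 0 < Num.sqrt a by rewrite sqrtr_gt0.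
  have [r] : exists r : rat, ratr r \in `]x ord0 i - Num.sqrt a, x ord0 i + Num.sqrt a[.
    by apply: rat_in_itvoo; lra.
  rewrite in_itv/= => /andP[r1 r2]; exists r.
  rewrite -[ltRHS]sqr_sqrtr ?(ltW a0)// -real_normK ?num_real//.
  rewrite ltrXn2r ?nnegrE// ltr_norml; lra.
have /choice[r rP] := ex.
exists (pickle (\row_i r i : 'rV[rat]_d)); rewrite pickleK.
apply: (@le_lt_trans _ _ (\sum_(i < d) a)).
  by apply: ler_sum => i _; rewrite !mxE ltW.
rewrite sumr_const card_ord -mulr_natr /a mulrAC ltr_pdivrMr// ltr_pM2l//.
by rewrite ltr_nat.
Qed.

Lemma fine_quantizer (R : realType) (d : nat) (mu nu : probability (borel_rV R d) R)
    (C1 C2 e : R) : poincare_bound mu C1 -> poincare_bound nu C2 -> 0 < e ->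
  exists (n : nat) (q : nat -> 'rV[R]_d) (k : borel_rV R d -> nat),
  [/\ measurable_fun setT k, forall x, (k x < n)%N,
     measurable_fun setT (fun x : borel_rV R d => sqnorm2 ((x : 'rV[R]_d) - q (k x))),
     (\int[mu]_x (sqnorm2 ((x : 'rV[R]_d) - q (k x)))%:E <= e%:E)%E &
     (\int[nu]_x (sqnorm2 ((x : 'rV[R]_d) - q (k x)))%:E <= e%:E)%E].
Proof.
move=> P1 P2 e0; have [q dq] := rational_dense R d.
have small (m : probability (borel_rV R d) R) C : poincare_bound m C ->
    \forall N \near \oo,
    (\int[m]_x (sqnorm2 ((x : 'rV[R]_d) - q (nearest q N x)))%:E <= e%:E)%E.
  move=> PC; have := nearest_integral_cvg dq PC.
  move=> /fine_cvgP[fN] /cvgrPdist_le/(_ e e0) h.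
  near=> N; have f1 : (\int[m]_x (sqnorm2 ((x : 'rV[R]_d) - q (nearest q N x)))%:E)%E
      \is a fin_num by near: N.
  rewrite -(fineK f1) lee_fin; apply: le_trans (ler_norm _) _.
  rewrite -normrN -sub0r; by near: N.
have [N [h1 h2]] : exists N,
   (\int[mu]_x (sqnorm2 ((x : 'rV[R]_d) - q (nearest q N x)))%:E <= e%:E)%E /\
   (\int[nu]_x (sqnorm2 ((x : 'rV[R]_d) - q (nearest q N x)))%:E <= e%:E)%E.
  near \oo => N; exists N; split; near: N; [exact: small P1|exact: small P2].
exists N.+1, q, (nearest q N); split=> //.
- exact: (measurable_nearest q N).1.
- by move=> x; exact: nearest_ltn.
- exact: (measurable_nearest q N).2.
Unshelve. all: by end_near. Qed.

(** * Couplings from a transport plan between cells *)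

Section glue.
Context (dX : measure_display) (X : measurableType dX) (R : realType).
Context (mu nu : probability X R) (n : nat) (k : X -> nat).
Hypotheses (mk : measurable_fun setT k) (kn : forall x, (k x < n)%N).
Context (w : nat -> nat -> {nonneg R}).

Let cell i := k @^-1` [set i].

Let mcell i : measurable (cell i).
Proof. by rewrite -[cell i]setTI; apply: mk. Qed.

Let mcell2 i j : measurable (cell i `*` cell j).
Proof. exact: measurableX. Qed.

(** On each block of cells the coupling is a multiple of the product measure, so the coordinates are
    independent given their cells. Under [w_row] and [w_col] the marginals are exactly [mu] and
    [nu], not discretised versions of them. *)
Definition glued : set (X * X) -> \bar R :=
  msum (fun i => msum (fun j =>
    mscale (w i j) (mrestr (mu \x nu)%E (mcell2 i j))) n) n.

HB.instance Definition _ := Measure.on glued.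

Let al i := fine (mu (cell i)).
Let be i := fine (nu (cell i)).
Hypothesis w_row : forall i, (i < n)%N -> \sum_(j < n) (w i j)%:num * (al i * be j) = al i.
Hypothesis w_col : forall j, (j < n)%N -> \sum_(i < n) (w i j)%:num * (al i * be j) = be j.

Lemma gluedE A D : measurable A -> measurable D ->
  (glued (A `*` D) = \sum_(i < n) \sum_(j < n)
     (w i j)%:num%:E * (mu (A `&` cell i) * nu (D `&` cell j)))%E.
Proof.
move=> mA mD; apply: eq_bigr => i _; apply: eq_bigr => j _.
transitivity ((w i j)%:num%:E *
    (mu \x nu) ((A `*` D) `&` (cell i `*` cell j)))%E; first by [].
by rewrite -setXI product_measure1E//; exact: measurableI.
Qed.

Lemma measure_cells (m : {measure set X -> \bar R}) A : measurable A ->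
  (m A = \sum_(i < n) m (A `&` cell i))%E.
Proof.
move=> mA; have mlt N : measurable [set x | (k x < N)%N].
  by have := mk measurableT (Y := [set i | (i < N)%N]) I; rewrite setTI.
suff ind N : (m (A `&` [set x | (k x < N)%N]) = \sum_(i < N) m (A `&` cell i))%E.
  rewrite -ind (_ : [set x | _] = setT) ?setIT//.
  by apply/seteqP; split=> // x _; exact: kn.
elim: N => [|N IH].
  by rewrite big_ord0 (_ : [set x | _] = set0) ?setI0 ?measure0// -subset0 => x.
rewrite big_ord_recr/= -IH -measureU.
- rewrite -setIUr; congr (m (A `&` _)); apply/seteqP; split=> x /=.
    by rewrite ltnS leq_eqVlt => /predU1P[|]; [right|left].
  by move=> [/ltnW|->].
- exact: measurableI.
- exact: measurableI.
- rewrite setIACA (_ : _ `&` cell N = set0) ?setI0// -subset0 => x /=.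
  by move=> [/[swap] ->]; rewrite ltnn.
Qed.

Lemma glued_fst A : measurable A -> glued (A `*` setT) = mu A.
Proof.
move=> mA; rewrite gluedE// (measure_cells mu mA); apply: eq_bigr => i _.
have mfin D : measurable D -> mu D = (fine (mu D))%:E.
  by move=> mD; rewrite fineK// fin_num_measure.
have nufin D : measurable D -> nu D = (fine (nu D))%:E.
  by move=> mD; rewrite fineK// fin_num_measure.
set a := fine (mu (A `&` cell i)).
have aE : mu (A `&` cell i) = a%:E by apply: mfin; exact: measurableI.
transitivity a%:E; last exact/esym/aE.
rewrite aE.
under eq_bigr => j _ do rewrite setTI (nufin _ (mcell j)) -!EFinM.
rewrite sumEFin; congr EFin.
have a_al : 0 <= a <= al i.
  rewrite /a fine_ge0//= fine_le//; try by rewrite fin_num_measure//; exact: measurableI.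
  by apply: le_measure => //; rewrite ?inE//; exact: measurableI.
(* On a null cell [w_row] cannot be divided by [al i], but there [a] vanishes by monotonicity. *)
have [ali0|ali0] := eqVneq (al i) 0.
  have -> : a = 0 by apply/eqP; rewrite eq_le -{1}ali0 andbC.
  by rewrite big1// => j _; rewrite mul0r mulr0.
apply: (mulfI ali0); rewrite [RHS]mulrC -[in RHS](w_row (ltn_ord i)) !mulr_sumr.
by apply: eq_bigr => j _; rewrite /be; ring.
Qed.

Lemma glued_snd A : measurable A -> glued (setT `*` A) = nu A.
Proof.
move=> mA; rewrite gluedE// (measure_cells nu mA) exchange_big/=; apply: eq_bigr => j _.
have mfin D : measurable D -> mu D = (fine (mu D))%:E.
  by move=> mD; rewrite fineK// fin_num_measure.
have nufin D : measurable D -> nu D = (fine (nu D))%:E.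
  by move=> mD; rewrite fineK// fin_num_measure.
set a := fine (nu (A `&` cell j)).
have aE : nu (A `&` cell j) = a%:E by apply: nufin; exact: measurableI.
transitivity a%:E; last exact/esym/aE.
rewrite aE.
under eq_bigr => i _ do rewrite setTI (mfin _ (mcell i)) -!EFinM.
rewrite sumEFin; congr EFin.
have a_be : 0 <= a <= be j.
  rewrite /a fine_ge0//= fine_le//; try by rewrite fin_num_measure//; exact: measurableI.
  by apply: le_measure => //; rewrite ?inE//; exact: measurableI.
have [bej0|bej0] := eqVneq (be j) 0.
  have -> : a = 0 by apply/eqP; rewrite eq_le -{1}bej0 andbC.
  by rewrite big1// => i _; rewrite !mulr0.
apply: (mulfI bej0); rewrite [RHS]mulrC -[in RHS](w_col (ltn_ord j)) !mulr_sumr.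
by apply: eq_bigr => i _; rewrite /al; ring.
Qed.

Lemma glued_cell i j : (i < n)%N -> (j < n)%N ->
  glued (cell i `*` cell j) = ((w i j)%:num * (al i * be j))%:E.
Proof.
move=> ni nj; rewrite gluedE// (bigD1 (Ordinal ni))//= (bigD1 (Ordinal nj))//=.
have disj a b : a != b -> cell a `&` cell b = set0.
  move=> /eqP ab; rewrite -subset0 => x [/= ka kb].
  by apply: ab; rewrite -ka -kb.
rewrite !setIid !big1 ?adde0.
- by rewrite !EFinM /al /be !fineK// fin_num_measure.
- move=> a ai; rewrite big1// => b _.
  have ia : i != a by apply: contra_neq ai => ia; exact/val_inj/esym.
  by rewrite disj// measure0 mul0e mule0.
- move=> b bj.
  have jb : j != b by apply: contra_neq bj => jb; exact/val_inj/esym.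
  by rewrite (disj j)// measure0 !mule0.
Qed.

Let glued_setT : glued setT = 1%:E.
Proof. by rewrite -setXTT glued_fst// probability_setT. Qed.

HB.instance Definition _ := Measure_isProbability.Build _ _ _ glued glued_setT.

Definition glued_probability : probability (X * X)%type R := glued.

End glue.

Section discrete_coupling.
Context (R : realType) (d : nat).
Local Notation V := 'rV[R]_d.
Local Notation B := (borel_rV R d).

(** The random variables are the two projections of the product space. *)
Lemma W2sq_le_coupling (mu nu : probability B R) (P : probability (B * B)%type R)
    (c : \bar R) :
  (forall A, measurable A -> P (A `*` setT) = mu A) ->
  (forall A, measurable A -> P (setT `*` A) = nu A) ->
  (\int[P]_z (sqnorm2 ((z.1 : V) - (z.2 : V)))%:E <= c)%E -> (W2sq mu nu <= c)%E.
Proof.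
move=> Pmu Pnu; apply: le_trans; apply: ereal_inf_lbound.
pose fst_mixin := isMeasurableFun.Build _ _ _ _ (@fst B B) measurable_fst.
pose X : {RV P >-> B} := HB.pack (@fst B B) fst_mixin.
pose snd_mixin := isMeasurableFun.Build _ _ _ _ (@snd B B) measurable_snd.
pose Y : {RV P >-> B} := HB.pack (@snd B B) snd_mixin.
exists _, (B * B)%type, P, X, Y; split.
- move=> A mA; rewrite -Pmu// /distribution /pushforward; congr (P _).
  by apply/seteqP; split=> [z /= Az|z [/=]].
- move=> A mA; rewrite -Pnu// /distribution /pushforward; congr (P _).
  by apply/seteqP; split=> [z /= Az|z [/=]].
- by rewrite unlock.
Qed.

Lemma measurable_sqdist :
  measurable_fun setT (fun z : B * B => sqnorm2 ((z.1 : V) - (z.2 : V))).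
Proof.
apply: measurable_sum => i; apply: (measurable_funX 2).
rewrite (_ : (fun x => _) = (fun z : B * B => (z.1 : V) ord0 i - (z.2 : V) ord0 i)).
  apply: measurable_funB.
    exact: (measurableT_comp (measurable_coord i) measurable_fst).
  exact: (measurableT_comp (measurable_coord i) measurable_snd).
by apply/funext => z; rewrite !mxE.
Qed.

Lemma sqnorm2N (x : V) : sqnorm2 (- x) = sqnorm2 x.
Proof. by apply: eq_bigr => i _; rewrite mxE sqrrN. Qed.

(** The coupling is [glued], with weights that give block [(i, j)] the mass [p i j]. By [sqnorm2D]
    the cost splits into the cost between representatives and two quantisation errors, whose sum is
    squared: [4 * e] is [2 * (e + e)]. *)
Lemma W2sq_le_discrete (mu nu : probability B R) (n : nat) (q : nat -> V)
    (k : B -> nat) (eta e : R) (p : 'I_n -> 'I_n -> R) :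
  measurable_fun setT k -> (forall x, (k x < n)%N) ->
  measurable_fun setT (fun x : B => sqnorm2 ((x : V) - q (k x))) ->
  (\int[mu]_x (sqnorm2 ((x : V) - q (k x)))%:E <= e%:E)%E ->
  (\int[nu]_x (sqnorm2 ((x : V) - q (k x)))%:E <= e%:E)%E ->
  0 < eta -> (forall i j, 0 <= p i j) ->
  (forall i : 'I_n, \sum_j p i j = fine (mu (k @^-1` [set nat_of_ord i]))) ->
  (forall j : 'I_n, \sum_i p i j = fine (nu (k @^-1` [set nat_of_ord j]))) ->
  (W2sq mu nu <= ((1 + eta) * (\sum_i \sum_j p i j * sqnorm2 (q i - q j)) +
    (1 + eta^-1) * (4 * e))%:E)%E.
Proof.
move=> mk kn mdist emu enu eta0 p0 prow pcol.
pose pn i j := if insub i is Some a then if insub j is Some b then p a b else 0 else 0.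
have pnE (i j : 'I_n) : pn i j = p i j by rewrite /pn !valK.
pose al i := fine (mu (k @^-1` [set i])); pose be i := fine (nu (k @^-1` [set i])).
have w0 i j : 0 <= pn i j / (al i * be j).
  rewrite divr_ge0 ?mulr_ge0 ?fine_ge0 ?measure_ge0//.
  by rewrite /pn; case: insubP => // a _ _; case: insubP.
pose w i j : {nonneg R} := NngNum (w0 i j).
(* If a cell of the block is null, the quotient is 0 by convention and [p i j] is 0 by its
   marginals. *)
have wE (i j : 'I_n) : (w i j)%:num * (al i * be j) = p i j.
  rewrite /= pnE; have [ab0|ab0] := eqVneq (al i * be j) 0; last by rewrite divfK.
  rewrite ab0 mulr0; apply/esym/eqP; rewrite eq_le p0 andbT.
  move/eqP: ab0; rewrite mulf_eq0 => /orP[] /eqP <-.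
    by rewrite /al -prow (bigD1 j)//= lerDl sumr_ge0.
  by rewrite /be -pcol (bigD1 i)//= lerDl sumr_ge0.
have wrow i : (i < n)%N -> \sum_(j < n) (w i j)%:num * (al i * be j) = al i.
  move=> ni; rewrite (eq_bigr (fun j => p (Ordinal ni) j)) ?prow//.
  by move=> j _; rewrite -(wE (Ordinal ni)).
have wcol j : (j < n)%N -> \sum_(i < n) (w i j)%:num * (al i * be j) = be j.
  move=> nj; rewrite (eq_bigr (fun i => p i (Ordinal nj))) ?pcol//.
  by move=> i _; rewrite -(wE _ (Ordinal nj)).
pose P := glued_probability mk kn wrow.
have Pfst A : measurable A -> P (A `*` setT) = mu A.
  by move=> mA; exact: (glued_fst mk kn wrow).
have Psnd A : measurable A -> P (setT `*` A) = nu A.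
  by move=> mA; exact: (glued_snd mk kn wcol).
have Pcell i j : (i < n)%N -> (j < n)%N ->
    P ((k @^-1` [set i]) `*` (k @^-1` [set j])) = ((w i j)%:num * (al i * be j))%:E.
  by move=> ni nj; exact: glued_cell.
apply: (W2sq_le_coupling Pfst Psnd).
have int_fst (h : B -> R) : measurable_fun setT h -> (forall x, 0 <= h x) ->
    (\int[P]_z (h z.1)%:E = \int[mu]_x (h x)%:E)%E.
  move=> mh h0.
  rewrite -(@ge0_integral_pushforward _ _ _ _ R (@fst B B) measurable_fst P setT
    (fun x => (h x)%:E))//; [|exact/measurable_EFinP|by move=> y _; rewrite lee_fin].
  apply: eq_measure_integral => A mA _; rewrite -[RHS](Pfst A mA) /pushforward; congr (P _).
  by apply/seteqP; split=> [z /= Az|z [/=]].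
have int_snd (h : B -> R) : measurable_fun setT h -> (forall x, 0 <= h x) ->
    (\int[P]_z (h z.2)%:E = \int[nu]_x (h x)%:E)%E.
  move=> mh h0.
  rewrite -(@ge0_integral_pushforward _ _ _ _ R (@snd B B) measurable_snd P setT
    (fun x => (h x)%:E))//; [|exact/measurable_EFinP|by move=> y _; rewrite lee_fin].
  apply: eq_measure_integral => A mA _; rewrite -[RHS](Psnd A mA) /pushforward; congr (P _).
  by apply/seteqP; split=> [z /= Az|z [/=]].
pose c i j := sqnorm2 (q i - q j).
pose A i j := (k @^-1` [set i]) `*` (k @^-1` [set j]).
have mcell i : measurable (k @^-1` [set i]).
  by have := mk measurableT [set i] I; rewrite setTI.
have mA i j : measurable (A i j) by apply: measurableX; exact: mcell.
(* The cost between representatives as a simple function, so that its integral is a finite sum. *)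
pose S (z : B * B) := \sum_(i < n) \sum_(j < n) c i j * \1_(A i j) z.
have SE z : S z = c (k z.1) (k z.2).
  rewrite /S (bigD1 (Ordinal (kn z.1)))//= (bigD1 (Ordinal (kn z.2)))//=.
  rewrite indicE mem_set// mulr1 !big1 ?addr0// => i ni.
    rewrite big1// => j _; rewrite indicE memNset ?mulr0// => -[/= zi _].
    by move: ni; rewrite -val_eqE/= zi eqxx.
  rewrite indicE memNset ?mulr0// => -[/= _ zi].
  by move: ni; rewrite -val_eqE/= zi eqxx.
have c0 i j : 0 <= c i j by exact: sqnorm2_ge0.
have mS : measurable_fun setT S.
  apply: measurable_sum => i; apply: measurable_sum => j.
  by apply: measurable_funM => //; exact: measurable_indic.
have intS : (\int[P]_z (S z)%:E = (\sum_i \sum_j p i j * c i j)%:E)%E.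
  under eq_integral do rewrite -sumEFin.
  rewrite ge0_integral_sum//=; last 2 first.
  - move=> i; apply/measurable_EFinP; apply: measurable_sum => j.
    by apply: measurable_funM => //; exact: measurable_indic.
  - by move=> i z _; rewrite lee_fin sumr_ge0// => j _; rewrite mulr_ge0.
  rewrite -sumEFin; apply: eq_bigr => i _.
  under eq_integral do rewrite -sumEFin.
  rewrite ge0_integral_sum//=; last 2 first.
  - by move=> j; apply/measurable_EFinP; apply: measurable_funM => //; exact: measurable_indic.
  - by move=> j z _; rewrite lee_fin mulr_ge0.
  rewrite -sumEFin; apply: eq_bigr => j _.
  under eq_integral do rewrite EFinM.
  rewrite ge0_integralZl//=; [|exact/measurable_EFinP/measurable_indic| by rewrite lee_fin].
  rewrite integral_indic// setIT.
  rewrite [X in (_ * X)%E](Pcell i j (ltn_ord i) (ltn_ord j)) -EFinM mulrC.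
  congr (_ * _)%:E.
  exact: wE.
pose h x := sqnorm2 ((x : V) - q (k x)).
have h0 x : 0 <= h x by exact: sqnorm2_ge0.
have mh1 : measurable_fun setT (fun z : B * B => h z.1).
  exact: (measurableT_comp mdist measurable_fst).
have mh2 : measurable_fun setT (fun z : B * B => h z.2).
  exact: (measurableT_comp mdist measurable_snd).
apply: (@le_trans _ _ (\int[P]_z ((1 + eta)%:E * (S z)%:E +
    (2 * (1 + eta^-1))%:E * ((h z.1)%:E + (h z.2)%:E)))%E).
  apply: ge0_le_integral => //.
  - by move=> z _; rewrite lee_fin sqnorm2_ge0.
  - by apply/measurable_EFinP; exact: measurable_sqdist.
  - apply/measurable_EFinP; apply: measurable_funD; first exact: measurable_funM.
    by apply: measurable_funM => //; exact: measurable_funD.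
  move=> z _; rewrite -[leRHS]/(((1 + eta) * S z + 2 * (1 + eta^-1) * (h z.1 + h z.2))%:E).
  rewrite lee_fin SE /c /h.
  set u := q (k z.1); set v := q (k z.2).
  have -> : (z.1 : V) - (z.2 : V) = (u - v) + (((z.1 : V) - u) - ((z.2 : V) - v)).
    by rewrite opprB addrACA -[in RHS]addrA; apply/rowP => i; rewrite !mxE; ring.
  apply: (le_trans (sqnorm2D _ _ eta0)); rewrite lerD2l.
  have := sqnorm2D ((z.1 : V) - u) (- ((z.2 : V) - v)) ltr01.
  rewrite sqnorm2N invr1 => h1.
  have e1 : 0 <= 1 + eta^-1 by rewrite addr_ge0// invr_ge0 ltW.
  apply: (le_trans (ler_wpM2l e1 h1)).
  by rewrite le_eqVlt; apply/orP; left; apply/eqP; ring.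
have eta1 : 0 <= 2 * (1 + eta^-1) by rewrite mulr_ge0// addr_ge0// invr_ge0 ltW.
rewrite ge0_integralD//=; last 4 first.
- by move=> z _; rewrite lee_fin mulr_ge0// ?SE ?c0// addr_ge0// ltW.
- by apply/measurable_EFinP; exact: measurable_funM.
- by move=> z _; rewrite lee_fin mulr_ge0// addr_ge0.
- by apply/measurable_EFinP; apply: measurable_funM => //; exact: measurable_funD.
rewrite ge0_integralZl//=; last 3 first.
- exact/measurable_EFinP.
- by move=> z _; rewrite lee_fin SE c0.
- by rewrite lee_fin addr_ge0// ltW.
rewrite ge0_integralZl//=; last 2 first.
- by apply/measurable_EFinP; exact: measurable_funD.
- by move=> z _; rewrite lee_fin addr_ge0.
rewrite ge0_integralD//=; last 4 first.
- by move=> z _; rewrite lee_fin.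
- exact/measurable_EFinP.
- by move=> z _; rewrite lee_fin.
- exact/measurable_EFinP.
rewrite [X in (_ * X + _)%E]intS [X in (_ * (X + _))%E](int_fst h mdist h0).
rewrite [X in (_ * (_ + X))%E](int_snd h mdist h0) -EFinM [leRHS]EFinD leeD2l//.
rewrite (_ : (1 + eta^-1) * (4 * e) = 2 * (1 + eta^-1) * (e + e)); last by ring.
by rewrite [leRHS]EFinM lee_wpmul2l ?lee_fin// EFinD leeD.
Qed.
End discrete_coupling.

(** * The bound *)

Lemma Rintegral_cells (dX : measure_display) (X : measurableType dX) (R : realType)
    (m : probability X R) (n : nat) (k : X -> nat) (F : nat -> R) :
  measurable_fun setT k -> (forall x, (k x < n)%N) ->
  m.-integrable setT (EFin \o (fun x => F (k x))) /\
  \int[m]_x F (k x) = \sum_(i < n) F i * fine (m (k @^-1` [set nat_of_ord i])).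
Proof.
move=> mk kn.
have mcell i : measurable (k @^-1` [set i]).
  by have := mk measurableT [set i] I; rewrite setTI.
have FE : (fun x => (F (k x))%:E) =
    (fun x => \sum_(i < n) (F i)%:E * (\1_(k @^-1` [set nat_of_ord i]) x)%:E)%E.
  apply/funext => x; rewrite (bigD1 (Ordinal (kn x)))//= big1 ?adde0.
    by rewrite indicE mem_set// mule1.
  move=> i ni; rewrite indicE memNset ?mule0// => /= ki.
  by move: ni; rewrite -val_eqE/= ki eqxx.
have ii (i : 'I_n) : m.-integrable setT
    (fun x => (F i)%:E * (\1_(k @^-1` [set nat_of_ord i]) x)%:E)%E.
  by apply: integrableZl => //; exact: integrable_indic.
split.
  rewrite [_ \o _]FE.
  exact: (@integrable_sum _ X R m setT measurableT 'I_n (index_enum 'I_n) xpredT _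
    (fun i _ => ii i)).
rewrite /Rintegral FE integral_sum//.
rewrite -sum_fine => [|i _]; last exact: (integrable_fin_num measurableT (ii i)).
apply: eq_bigr => i _; rewrite integralZl//; last exact: integrable_indic.
by rewrite integral_indic// setIT fineM// fin_num_measure.
Qed.

Lemma sum_cells (dX : measure_display) (X : measurableType dX) (R : realType)
    (m : probability X R) (n : nat) (k : X -> nat) :
  measurable_fun setT k -> (forall x, (k x < n)%N) ->
  \sum_(i < n) fine (m (k @^-1` [set nat_of_ord i])) = 1.
Proof.
move=> mk kn; have [_] := Rintegral_cells m (fun=> 1) mk kn.
rewrite Rintegral_cst// [X in fine X](probability_setT m) mul1r => E; apply/esym; apply: (etrans E).
by apply: eq_bigr => i _; rewrite mul1r.
Qed.

Section assembly.
Context (R : realType) (d : nat).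
Local Notation V := 'rV[R]_d.
Local Notation B := (borel_rV R d).
Context (mu nu : probability B R) (C1 C2 r t : R).
Hypotheses (P1 : poincare_bound mu C1) (P2 : poincare_bound nu C2).
Hypotheses (C10 : 0 < C1) (C20 : 0 < C2) (TVt : TV mu nu = t%:E) (t1 : t < 1).
Hypothesis (rt : t / (1 - t) < r).

(* [eta] is at once the starting time of the soft-min flow, the loss in
   [|u + v|^2 <= (1 + eta) |u|^2 + (1 + 1/eta) |v|^2], and the square root of the
   quantisation error. *)
Lemma W2sq_approx (eta : R) : 0 < eta < 2^-1 ->
  (W2sq mu nu <= ((1 + eta) * (2 * (1 + eta) *
     (2 * r * (C1 + C2) / (1 - eta) + 2 * eta)) +
     (1 + eta^-1) * (4 * eta ^+ 2))%:E)%E.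
Proof.
move=> /andP[eta0 eta2].
have e0 : 0 < eta ^+ 2 by rewrite exprn_gt0.
have [n [q [k [mk kn mh emu enu]]]] := fine_quantizer P1 P2 e0.
have n0 : (0 < n)%N by apply: leq_trans (kn 0).
pose al (i : 'I_n) := fine (mu (k @^-1` [set nat_of_ord i])).
pose be (i : 'I_n) := fine (nu (k @^-1` [set nat_of_ord i])).
pose c (i j : 'I_n) := sqnorm2 (q i - q j).
pose h (x : B) := sqnorm2 ((x : V) - q (k x)).
have h0 x : 0 <= h x by exact: sqnorm2_ge0.
set K := 2 * (1 + eta) * _.
have hint (m : probability B R) :
    (\int[m]_x (sqnorm2 ((x : V) - q (k x)))%:E <= (eta ^+ 2)%:E)%E ->
    m.-integrable setT (EFin \o h) /\ \int[m]_x h x <= eta ^+ 2.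
  move=> hm; have hi : m.-integrable setT (EFin \o h).
    apply/integrableP; split; first exact/measurable_EFinP.
    apply: le_lt_trans (ltry (eta ^+ 2)); apply: le_trans hm.
    rewrite le_eqVlt; apply/orP; left; apply/eqP; apply: eq_integral => x _ /=.
    by rewrite ger0_norm.
  split=> //; rewrite -lee_fin fineK//; exact: (integrable_fin_num measurableT hi).
have [hmu Emu] := hint _ emu; have [hnu Enu] := hint _ enu.
have dual (f g : 'I_n -> R) : (forall i j, f i + g j <= c i j) ->
    \sum_i f i * al i + \sum_j g j * be j <= K.
  move=> fg.
  (* Makes the soft-min error [eps * ln n%:R] at most [eta]; the [+ 1] covers [n = 1], where the
     logarithm vanishes. *)
  pose eps := eta / (ln n%:R + 1).
  have ln0 : 0 <= ln n%:R :> R by rewrite ln_ge0// ler1n.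
  have eps0 : 0 < eps by rewrite divr_gt0//; lra.
  have epsl : eps * ln n%:R <= eta.
    by rewrite /eps mulrAC ler_pdivrMr; [rewrite ler_wpM2l//; lra|lra].
  (* Scaling by [b] turns the factor [1 + eta] into the [1 / 2] of the soft-min at time 1, and
     [1 + eta^-1] into [eta^-1 / 2]. *)
  pose b := (2 * (1 + eta))^-1.
  have b0 : 0 < b by rewrite invr_gt0; lra.
  (* Up to small errors, the flow started from [- b * f] is at most [- b * f] at time [eta] and at
     least [b * g] at time 1. *)
  pose ff (i : 'I_n) := - b * f i.
  pose y (i : 'I_n) := q i.
  have s01 : 0 < eta < 1 by lra.
  have gap := dual_gap ff y n0 eps0 P1 P2 C10 C20 TVt t1 s01 rt.
  pose fn i := if insub i is Some a then ff a else 0.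
  pose gn i := if insub i is Some a then g a else 0.
  have fnE (i : 'I_n) : fn i = ff i by rewrite /fn valK.
  have gnE (i : 'I_n) : gn i = g i by rewrite /gn valK.
  have [fi fI] := Rintegral_cells mu fn mk kn.
  have [gi gI] := Rintegral_cells nu gn mk kn.
  have eta_ge0 := ltW eta0.
  have etai0 : 0 <= eta^-1 by rewrite invr_ge0.
  (* The soft-min is tested at the representative of the cell of [x]; the error [h x / (2 * eta)]
     integrates to at most [eta / 2]. *)
  have upper : \int[mu]_x softmin eps ff y eta^-1 x <=
      - b * (\sum_i f i * al i) + eta / 2 + eta.
    have ci := integrable_cst_prob mu eta.
    have i1 := integrable_addZ 1 (eta^-1 / 2) fi hmu.
    have i2 := integrable_addZ 1 1 i1 ci.
    apply: (@le_trans _ _ (\int[mu]_x (1 * (1 * fn (k x) + eta^-1 / 2 * h x) + 1 * eta))).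
      apply: le_Rintegral => //; first exact: (integrable_softmin _ _ n0 eps0 P1).
      move=> x _; have := softmin_le ff y n0 eps0 eta^-1 x (Ordinal (kn x)).
      by rewrite -fnE /= /y /= -/(h x); lra.
    rewrite (_ : (fun x => _) = (fun x => (fn (k x) + eta^-1 / 2 * h x) + eta)); last first.
      by apply/funext => x; rewrite !mul1r.
    rewrite RintegralD//; last by move: i1; apply: eq_integrable => // x _ /=; rewrite mul1r.
    rewrite RintegralD//; last first.
      have := integrable_addZ (eta^-1 / 2) 0 hmu hmu.
      by apply: eq_integrable => // x _ /=; rewrite mul0r addr0.
    rewrite RintegralZl// Rintegral_cst// [X in fine X](probability_setT mu) mulr1 fI.
    rewrite lerD2r lerD//.
      rewrite le_eqVlt; apply/orP; left; apply/eqP; rewrite mulr_sumr.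
      by apply: eq_bigr => i _; rewrite fnE /ff mulrA.
    apply: (@le_trans _ _ (eta^-1 / 2 * eta ^+ 2)).
      by rewrite ler_wpM2l// divr_ge0.
    by rewrite le_eqVlt; apply/orP; left; apply/eqP; field; rewrite gt_eqF.
  (* Dual feasibility for [j] and the cell of [x] bounds every term of the soft-min from below, up
     to [h x / (2 * eta)]. *)
  have lower : b * (\sum_j g j * be j) - eta / 2 <= \int[nu]_x softmin eps ff y 1 x.
    have i1 := integrable_addZ b (- (eta^-1 / 2)) gi hnu.
    apply: (@le_trans _ _ (\int[nu]_x (b * gn (k x) + - (eta^-1 / 2) * h x))); last first.
      apply: le_Rintegral => //; first exact: (integrable_softmin _ _ n0 eps0 P2).
      move=> x _; apply: le_softmin => // j.
      have := fg j (Ordinal (kn x)); rewrite -gnE /c /= => fgj.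
      have := sqnorm2D (q j - (x : V)) ((x : V) - q (k x)) eta0.
      rewrite addrA subrK -(sqnorm2N (q j - _)) opprB -/(h x) => sq.
      have {}sq : b * (f j + gn (k x)) <=
          b * ((1 + eta) * sqnorm2 ((x : V) - q j) + (1 + eta^-1) * h x).
        by rewrite ler_wpM2l ?(ltW b0)//; apply: le_trans fgj sq.
      have bE : b * ((1 + eta) * sqnorm2 ((x : V) - q j) + (1 + eta^-1) * h x) =
          1 / 2 * sqnorm2 ((x : V) - q j) + eta^-1 / 2 * h x.
        by rewrite /b; field; rewrite !gt_eqF//; lra.
      move: sq; rewrite bE /ff /y; lra.
    rewrite RintegralD//; last 2 first.
    - have := integrable_addZ b 0 gi gi.
      by apply: eq_integrable => // x _ /=; rewrite mul0r addr0.
    - have := integrable_addZ (- (eta^-1 / 2)) 0 hnu hnu.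
      by apply: eq_integrable => // x _ /=; rewrite mul0r addr0.
    rewrite !RintegralZl// gI lerD//.
      rewrite le_eqVlt; apply/orP; left; apply/eqP; congr (_ * _).
      by apply: eq_bigr => i _; rewrite gnE.
    rewrite mulNr lerN2; apply: (@le_trans _ _ (eta^-1 / 2 * eta ^+ 2)).
      by rewrite ler_wpM2l// divr_ge0.
    by rewrite le_eqVlt; apply/orP; left; apply/eqP; field; rewrite gt_eqF.
  have gap' : \int[nu]_x softmin eps ff y 1 x - \int[mu]_x softmin eps ff y eta^-1 x <=
      2 * r * (C1 + C2) / (1 - eta).
    by rewrite ler_pdivlMr 1?mulrC//; lra.
  have : b * (\sum_i f i * al i + \sum_j g j * be j) <=
      2 * r * (C1 + C2) / (1 - eta) + 2 * eta by lra.
  by rewrite /b ler_pdivrMl//; lra.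
have [||||p [p0 prow pcol pK]] := @transport_duality R n al be c K _ _ _ _ dual.
- by move=> i; rewrite fine_ge0.
- by move=> i; rewrite fine_ge0.
- exact: sum_cells.
- exact: sum_cells.
have := W2sq_le_discrete mk kn mh emu enu eta0 p0 prow pcol.
move=> /le_trans; apply; rewrite lee_fin lerD2r ler_wpM2l//; lra.
Qed.

(** Let [eta] tend to 0 in [W2sq_approx]. One factor 2 of the constant comes from the halved cost in
    the soft-min, the other from [interpolation_bound]. *)
Lemma W2sq_bound : 0 <= t -> (W2sq mu nu <= (4 * r * (C1 + C2))%:E)%E.
Proof.
move=> t0; apply/lee_addgt0Pr => dl dl0.
have r0 : 0 < r.
  have t1' : 0 < 1 - t by rewrite subr_gt0.
  by apply: le_lt_trans rt; rewrite divr_ge0// ltW.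
set Q := 4 * r * (C1 + C2).
have C12 : 0 < C1 + C2 by rewrite addr_gt0.
have Q0 : 0 <= Q by rewrite /Q mulr_ge0 ?(ltW C12)// mulr_ge0// ltW.
(* The summand [2 * dl] ensures [eta < 2^-1], under which [h1] and [h2] bound the excess over [Q] by
   [eta * (8 * Q + 15)]. *)
pose D := 8 * Q + 15 + 2 * dl.
have D0 : 0 < D by rewrite /D; lra.
pose eta := dl / D.
have eta0 : 0 < eta by rewrite divr_gt0.
have eta2 : eta < 2^-1.
  by rewrite /eta ltr_pdivrMr// /D; lra.
have etaD : eta * (8 * Q + 15) <= dl.
  by rewrite /eta mulrAC ler_pdivrMr// ler_wpM2l ?(ltW dl0)// /D; lra.
have eta02 : 0 < eta < 2^-1 by rewrite eta0.
apply: (le_trans (W2sq_approx eta02)); rewrite -EFinD lee_fin.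
apply: (@le_trans _ _ (Q + eta * (8 * Q + 15))); last by rewrite lerD2l.
have e1 : 0 < 1 - eta by lra.
have -> : (1 + eta) * (2 * (1 + eta) * (2 * r * (C1 + C2) / (1 - eta) + 2 * eta)) +
    (1 + eta^-1) * (4 * eta ^+ 2) =
    Q * ((1 + eta) ^+ 2 / (1 - eta)) +
    (4 * eta * (1 + eta) ^+ 2 + 4 * eta * (1 + eta)).
  by rewrite /Q; field; rewrite !gt_eqF.
have h1 : (1 + eta) ^+ 2 / (1 - eta) <= 1 + 8 * eta.
  by rewrite ler_pdivrMr//; nra.
have h2 : 4 * eta * (1 + eta) ^+ 2 + 4 * eta * (1 + eta) <= 15 * eta by nra.
have := ler_wpM2l Q0 h1; lra.
Qed.
End assembly.

(** * Total variation and Poincare constants *)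

Section total_variation.
Context (R : realType) (d : nat) (mu nu : probability (borel_rV R d) R).

Lemma TV_ge A : measurable A -> (`|mu A - nu A| <= TV mu nu)%E.
Proof. by move=> mA; apply: ereal_sup_ubound; exists A. Qed.

Lemma TV_ge0 : (0 <= TV mu nu)%E.
Proof. exact: le_trans (abse_ge0 _) (TV_ge measurableT). Qed.

Lemma TV_le1 : (TV mu nu <= 1)%E.
Proof.
apply: ge_ereal_sup => _ [A mA <-].
have muf : mu A \is a fin_num by exact: fin_num_measure.
have nuf : nu A \is a fin_num by exact: fin_num_measure.
have mu1 : (mu A <= 1)%E by exact: probability_le1.
have nu1 : (nu A <= 1)%E by exact: probability_le1.
have mu0 : (0 <= mu A)%E by exact: measure_ge0.
have nu0 : (0 <= nu A)%E by exact: measure_ge0.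
move: mu1 nu1 mu0 nu0; rewrite -(fineK muf) -(fineK nuf) !lee_fin => *.
by rewrite ler_norml; apply/andP; split; lra.
Qed.

(** Here [mu] and [nu] agree on measurable sets, so the diagonal coupling is admissible. The case
    stands apart because the right-hand side is then 0 by convention even if a Poincare constant is
    infinite. *)
Lemma W2sq_TV0 : TV mu nu = 0%E -> (W2sq mu nu <= 0)%E.
Proof.
move=> TV0; apply: ereal_inf_lbound.
pose id_mixin := isMeasurableFun.Build _ _ _ _ (@id (borel_rV R d)) (@measurable_id _ _ setT).
pose X : {RV mu >-> borel_rV R d} := HB.pack (@id (borel_rV R d)) id_mixin.
exists _, (borel_rV R d), mu, X, X; split=> //.
- move=> A mA; have := TV_ge mA; rewrite TV0 => munu.
  have muf : mu A \is a fin_num by exact: fin_num_measure.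
  have nuf : nu A \is a fin_num by exact: fin_num_measure.
  rewrite -[LHS]/(mu A) -(fineK muf) -(fineK nuf); congr EFin.
  move: munu; rewrite -(fineK muf) -(fineK nuf) lee_fin normr_le0 subr_eq0.
  by move=> /eqP.
- rewrite unlock; apply/esym; apply: integral0_eq => x _.
  by rewrite subrr /sqnorm2 big1// => i _; rewrite mxE expr0n.
Qed.

Lemma poincare_bound_le (C C' : R) : C <= C' -> poincare_bound mu C ->
  poincare_bound mu C'.
Proof.
move=> CC' [C0 h]; split=> [|f sf]; first exact: le_trans CC'.
apply: (le_trans (h f sf)); apply: lee_wpmul2r; last by rewrite lee_fin.
by apply: integral_ge0 => x _; rewrite lee_fin sqnorm2_ge0.
Qed.

Lemma CP_ge0 : (0 <= CP mu)%E.
Proof. by apply: le_ereal_inf_tmp => _ [C [C0 _] <-]; rewrite lee_fin. Qed.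

(** Poincare bounds persist under enlargement, so [a + dl] itself serves: it is positive, and the
    infimum need not be attained. *)
Lemma CP_approx (a dl : R) : CP mu = a%:E -> 0 < dl ->
  exists2 C, 0 < C <= a + dl & poincare_bound mu C.
Proof.
move=> CPa dl0; have a0 : 0 <= a by rewrite -lee_fin -CPa CP_ge0.
have : (CP mu < (a + dl)%:E)%E by rewrite CPa lte_fin ltrDl.
move=> /ereal_inf_lt[_ [C PC <-]]; rewrite lte_fin => Cdl.
exists (a + dl); first by rewrite lexx andbT; lra.
exact: poincare_bound_le (ltW Cdl) PC.
Qed.

End total_variation.

Local Open Scope ereal_scope.

Theorem theorem1p6 (R : realType) (d : nat)
    (mu nu : probability (borel_rV R d) R) :
  W2sq mu nu <=
    if TV mu nu == 1 then +oo
    else 4%:E * (CP mu + CP nu) * TV mu nu / (1 - TV mu nu).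
Proof.
case: ifPn => [_|TV1]; first exact: leey.
have tvf : TV mu nu \is a fin_num.
  by rewrite ge0_fin_numE ?TV_ge0// (le_lt_trans (TV_le1 _ _))// ltry.
have [TV0|TVn0] := eqVneq (TV mu nu) 0.
  by rewrite TV0 mule0 mul0e; exact: W2sq_TV0.
have := TV_ge0 mu nu; have := TV_le1 mu nu.
have [t TVt] : exists t : R, TV mu nu = t%:E by exists (fine (TV mu nu)); rewrite fineK.
move: TV1 TVn0; rewrite TVt !eqe => t1 tn0; rewrite !lee_fin => tle1 t0.
have {}t1 : (t < 1)%R by rewrite lt_neqAle t1.
have {}tn0 : (0 < t)%R by rewrite lt_def tn0.
have t1' : (0 < 1 - t)%R by rewrite subr_gt0.
rewrite -EFinD inver gt_eqF//.
have tt0 : 0 < t%:E * ((1 - t)^-1)%:E by rewrite -EFinM lte_fin divr_gt0.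
rewrite -muleA.
(* As [t] is positive, an infinite Poincare constant makes the right-hand side [+oo]; only finite
   ones call for an estimate. *)
have [[a CPa]|CPoo] : (exists a : R, CP mu = a%:E) \/ CP mu = +oo.
  by move: (CP_ge0 mu); case: (CP mu) => [a _|_|//]; [left; exists a|right].
  have [[b CPb]|CPoo] : (exists b : R, CP nu = b%:E) \/ CP nu = +oo.
    by move: (CP_ge0 nu); case: (CP nu) => [b _|_|//]; [left; exists b|right].
    have a0 : (0 <= a)%R by rewrite -lee_fin -CPa CP_ge0.
    have b0 : (0 <= b)%R by rewrite -lee_fin -CPb CP_ge0.
    rewrite CPa CPb -!EFinD -!EFinM; apply/lee_addgt0Pr => e e0.
    pose rho := (t / (1 - t))%R.
    have rho0 : (0 <= rho)%R by rewrite divr_ge0// ltW.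
    (* Enlarging [rho] and both constants by [dl] creates the excess
       [dl * (8 * rho + 4 * (a + b) + 8 * dl)]; [D] is chosen to keep it below [e]. *)
    pose D := (16 * rho + 4 * (a + b) + 16 + e)%R.
    have D0 : (0 < D)%R by rewrite /D; lra.
    pose dl := (e / D)%R.
    have dl0 : (0 < dl)%R by rewrite divr_gt0.
    have dl1 : (dl <= 1)%R by rewrite /dl ler_pdivrMr// mul1r /D; lra.
    have dlD : (dl * (8 * rho + 4 * (a + b) + 8 * dl) <= e)%R.
      rewrite -[leRHS](divfK (lt0r_neq0 D0)) -/dl ler_wpM2l ?(ltW dl0)// /D; lra.
    have [C1 /andP[C10 C1a] P1] := CP_approx CPa dl0.
    have [C2 /andP[C20 C2b] P2] := CP_approx CPb dl0.
    have rt : (t / (1 - t) < rho + dl)%R by rewrite ltrDl.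
    apply: (le_trans (W2sq_bound P1 P2 C10 C20 TVt t1 rt t0)).
    rewrite -EFinD lee_fin.
    apply: (@le_trans _ _ (4 * (rho + dl) * ((a + dl) + (b + dl)))%R).
      by rewrite ler_wpM2l ?lerD// mulr_ge0//; lra.
    rewrite mulrA -[(4 * (a + b) * t / (1 - t))%R]mulrA -/rho; lra.
  rewrite CPoo CPa addey// gt0_muley ?lte_fin// gt0_mulye ?leey//.
rewrite CPoo addye ?gt0_muley ?lte_fin// ?gt0_mulye ?leey//.
by rewrite gt_eqF// (lt_le_trans _ (CP_ge0 nu))// ltNyr.
Qed.
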